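(* Let $M=\Gamma\backslash G$ be the Iwasawa manifold, and for real numbers $s,t$ with $t\neq 0$ let $J_{s,t}$ be the invariant complex structure on $M$ defined in the context. Then the complex manifold $(M,J_{s,t})$ admits a Hermitian metric for which the Ricci tensor of the Bismut connection vanishes if and only if $s=0$.
   Context: $G$ is the complex Heisenberg group of matrices $\begin{pmatrix}1&z^1&z^3\\0&1&z^2\\0&0&1\end{pmatrix}$ with $z^1,z^2,z^3\in\mathbb{C}$, viewed as a 6-dimensional real Lie group, and $\Gamma\subset G$ is the discrete subgroup for which the $z^i$ are Gaussian integers; $M=\Gamma\backslash G$ is the Iwasawa manifold (compact). For $s,t\in\mathbb{R}$, $t\ne0$, let $\mathfrak g_{s,t}$ be the real 6-dimensional Lie algebra whose dual has a basis $e^1,\dots,e^6$ with $$de^i=0\ (i=1,\dots,4),\quad de^5=s\,e^1\wedge e^2+2s\,e^3\wedge e^4+t\,e^1\wedge e^3-t\,e^2\wedge e^4,\quad de^6=t\,e^1\wedge e^4+t\,e^2\wedge e^3$$ (where $d\alpha(X,Y)=-\alpha([X,Y])$), with the complex structure $J$ given on 1-forms by $Je^1=e^2$, $Je^3=e^4$, $Je^5=e^6$, whose $(1,0)$-forms are spanned by $\omega_1=e^1+ie^2$, $\omega_2=e^3+ie^4$, $\omega_3=e^5+ie^6$. One has $d\omega_1=d\omega_2=0$ and $d\omega_3=\frac12 is\,\omega_1\wedge\overline\omega_1+is\,\omega_2\wedge\overline\omega_2+t\,\omega_1\wedge\omega_2$. For every $t\neq0$, $\mathfrak g_{s,t}$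 is isomorphic as a real Lie algebra to the Lie algebra of $G$; via such an isomorphism $J$ gives a left-invariant complex structure on $G$, which descends to the complex structure $J_{s,t}$ on $M$. For a Hermitian manifold $(M,J,g)$ of complex dimension $n$, the Bismut connection $\nabla^B$ is the unique connection with $\nabla^Bg=0$, $\nabla^BJ=0$ whose torsion $T^B$ is such that $g(X,T^B(Y,Z))$ is totally skew-symmetric. Its ''Ricci tensor'' here means its Ricci form, which represents up to a constant the first Chern class: with $R^B$ the curvature of $\nabla^B$ and $e_1,\dots,e_{2n}$ a local orthonormal frame, $Ric^B(X,Y)=\frac12\sum_{i=1}^{2n}g(R^B(X,Y)e_i,Je_i)$ (sign and normalization are irrelevant for its vanishing). *)

(* Defs.v *)
From HB Require Import structures.
From mathcomp Require Import all_boot all_order all_algebra complex.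
From mathcomp Require Import all_classical all_reals all_analysis.
Import Order.TTheory GRing.Theory Num.Theory.
Import numFieldNormedType.Exports.

Set Implicit Arguments.
Unset Strict Implicit.
Unset Printing Implicit Defensive.

Local Open Scope ring_scope.
Local Open Scope classical_set_scope.

(* Indices are 0-based: e^1, ..., e^6 are the coordinates 0, ..., 5 of a row
   vector, so that the element of the Heisenberg group with entries z^1, z^2,
   z^3 has coordinates (Re z^1, Im z^1, Re z^2, Im z^2, Re z^3, Im z^3). *)

Section Heisenberg.
Variable R : realType.
Local Notation V := 'rV[R]_6.

Definition heis_z1 (x : V) : complex R := Complex (x 0 0) (x 0 1).
Definition heis_z2 (x : V) : complex R := Complex (x 0 2) (x 0 3).
Definition heis_z3 (x : V) : complex R := Complex (x 0 4) (x 0 5).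

Definition heis_mx (x : V) : 'M[complex R]_3 :=
  \matrix_(i, j) (nth [::] [:: [:: 1; heis_z1 x; heis_z3 x];
                               [:: 0; 1; heis_z2 x];
                               [:: 0; 0; 1]] i)`_j.

Definition heis_nil (x : V) : 'M[complex R]_3 :=
  \matrix_(i, j) (nth [::] [:: [:: 0; heis_z1 x; heis_z3 x];
                               [:: 0; 0; heis_z2 x];
                               [:: 0; 0; 0]] i)`_j.

Definition heis_coord (A : 'M[complex R]_3) : V :=
  \row_k [:: complex.Re (A 0 1); complex.Im (A 0 1);
             complex.Re (A 1 2); complex.Im (A 1 2);
             complex.Re (A 0 2); complex.Im (A 0 2)]`_k.

Definition heis_mul (x y : V) : V := heis_coord (heis_mx x *m heis_mx y).

Definition heis_inv (x : V) : V := heis_coord (invmx (heis_mx x)).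

(* The Lie algebra of G, identified with the tangent space at the identity 0. *)
Definition heis_br (u v : V) : V :=
  heis_coord (heis_nil u *m heis_nil v - heis_nil v *m heis_nil u).

Definition gauss (x : V) : Prop := forall k, x 0 k \is a Num.int.

(* d(L_x)_y : T_y G -> T_(xy) G. *)
Definition dleft (x y : V) : V -> V := 'd (heis_mul x) y.

End Heisenberg.

Section LieAlgebra.
Variable R : realType.
Local Notation V := 'rV[R]_6.

(* e^(k+1) /\ e^(l+1), normalised as demanded by d alpha(X,Y) = -alpha([X,Y]). *)
Definition wedge (k l : 'I_6) (u v : V) : R := u 0 k * v 0 l - u 0 l * v 0 k.

Definition de5 (s t : R) (u v : V) : R :=
  s * wedge 0 1 u v + 2 * s * wedge 2 3 u v
  + t * wedge 0 2 u v - t * wedge 1 3 u v.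

Definition de6 (t : R) (u v : V) : R := t * wedge 0 3 u v + t * wedge 1 2 u v.

(* The bracket of g_{s,t}, in the basis dual to e^1, ..., e^6. *)
Definition gst_br (s t : R) (u v : V) : V :=
  \row_k [:: 0; 0; 0; 0; - de5 s t u v; - de6 t u v]`_k.

(* J on vectors: as e^1 + i e^2 is of type (1,0), i.e.
   omega(JX) = i omega(X), J maps e_1 to e_2 and e_2 to - e_1; likewise for
   the two other pairs. *)
Definition gst_J (u : V) : V :=
  \row_k [:: - u 0 1; u 0 0; - u 0 3; u 0 2; - u 0 5; u 0 4]`_k.

(* The isomorphism is u |-> u *m phi, from g_{s,t} to the Lie algebra of G. *)
Definition lie_iso (s t : R) (phi : 'M[R]_6) : Prop :=
  phi \in unitmx /\
  forall u v : V, heis_br (u *m phi) (v *m phi) = gst_br s t u v *m phi.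

(* The left-invariant almost complex structure on G induced via phi, as an
   endomorphism of T_x G. *)
Definition Jphi (phi : 'M[R]_6) (x u : V) : V :=
  dleft x 0 (gst_J (dleft (heis_inv x) x u *m invmx phi) *m phi).

End LieAlgebra.

(* As Gamma acts on G freely and
   properly discontinuously by left translations, smooth functions, vector
   fields and metrics on M = Gamma \ G are the same as Gamma-invariant smooth
   ones on G, and G is covered by a single chart. *)
Section Geometry.
Variable R : realType.
Local Notation V := 'rV[R]_6.

Fixpoint Ck (W : normedModType R) (k : nat) (f : V -> W) : Prop :=
  match k with
  | 0 => continuous f
  | k'.+1 => (forall x, differentiable f x) /\
             forall v, Ck k' (fun x => 'D_v f x)
  end.

Definition smooth (W : normedModType R) (f : V -> W) : Prop :=
  forall k, Ck k f.

Definition M_fun (f : V -> R) : Prop :=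
  smooth f /\ forall a x, gauss a -> f (heis_mul a x) = f x.

Definition M_field (X : V -> V) : Prop :=
  smooth X /\ forall a x, gauss a -> X (heis_mul a x) = dleft a x (X x).

Definition field_br (X Y : V -> V) : V -> V :=
  fun x => 'D_(X x) Y x - 'D_(Y x) X x.

(* A metric is given by its Gram matrices in the coordinates of G. *)
Definition gval (g : V -> 'M[R]_6) (x u v : V) : R := (u *m g x *m v^T) 0 0.

Definition M_metric (g : V -> 'M[R]_6) : Prop :=
  [/\ smooth g,
      forall a x u v, gauss a ->
        gval g (heis_mul a x) (dleft a x u) (dleft a x v) = gval g x u v,
      forall x u v, gval g x u v = gval g x v u
    & forall x u, u != 0 -> 0 < gval g x u u].

Definition hermitian_metric (J : V -> V -> V) (g : V -> 'M[R]_6) : Prop :=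
  M_metric g /\ forall x u v, gval g x (J x u) (J x v) = gval g x u v.

(* Affine connections on M; the value of nabla on arguments that are not
   smooth vector fields on M is irrelevant. *)
Definition M_connection (nabla : (V -> V) -> (V -> V) -> (V -> V)) : Prop :=
  [/\ forall X Y, M_field X -> M_field Y -> M_field (nabla X Y),
      forall X X' Y, M_field X -> M_field X' -> M_field Y ->
        nabla (X \+ X') Y = nabla X Y \+ nabla X' Y,
      forall f X Y, M_fun f -> M_field X -> M_field Y ->
        nabla (fun x => f x *: X x) Y = (fun x => f x *: nabla X Y x),
      forall X Y Y', M_field X -> M_field Y -> M_field Y' ->
        nabla X (Y \+ Y') = nabla X Y \+ nabla X Y'
    & forall f X Y, M_fun f -> M_field X -> M_field Y ->
        nabla X (fun x => f x *: Y x)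
        = (fun x => 'D_(X x) f x *: Y x + f x *: nabla X Y x)].

Definition torsion (nabla : (V -> V) -> (V -> V) -> (V -> V))
    (X Y : V -> V) : V -> V :=
  fun x => nabla X Y x - nabla Y X x - field_br X Y x.

Definition curvature (nabla : (V -> V) -> (V -> V) -> (V -> V))
    (X Y Z : V -> V) : V -> V :=
  fun x => nabla X (nabla Y Z) x - nabla Y (nabla X Z) x
           - nabla (field_br X Y) Z x.

(* The last clause is skewness in the first two arguments; skewness in the last
   two always holds for a torsion. *)
Definition bismut_connection (J : V -> V -> V) (g : V -> 'M[R]_6)
    (nabla : (V -> V) -> (V -> V) -> (V -> V)) : Prop :=
  [/\ M_connection nabla,
      forall X Y Z, M_field X -> M_field Y -> M_field Z -> forall x,
        'D_(X x) (fun y => gval g y (Y y) (Z y)) x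
        = gval g x (nabla X Y x) (Z x) + gval g x (Y x) (nabla X Z x),
      forall X Y, M_field X -> M_field Y -> forall x,
        nabla X (fun y => J y (Y y)) x = J x (nabla X Y x)
    & forall X Y Z, M_field X -> M_field Y -> M_field Z -> forall x,
        gval g x (X x) (torsion nabla Y Z x)
        = - gval g x (Y x) (torsion nabla X Z x)].

Definition ricci_form (J : V -> V -> V) (g : V -> 'M[R]_6)
    (nabla : (V -> V) -> (V -> V) -> (V -> V))
    (e : 'I_6 -> V -> V) (X Y : V -> V) (x : V) : R :=
  2^-1 * \sum_i gval g x (curvature nabla X Y (e i) x) (J x (e i x)).

(* The curvature is a tensor, so the Ricci form at x only depends on the frame
   through its values at x; hence a local orthonormal frame is replaced by
   vector fields on M that are orthonormal at x. *)
Definition ricci_flat (J : V -> V -> V) (g : V -> 'M[R]_6)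
    (nabla : (V -> V) -> (V -> V) -> (V -> V)) : Prop :=
  forall (x : V) (e : 'I_6 -> V -> V), (forall i, M_field (e i)) ->
    (forall i j, gval g x (e i x) (e j x) = (i == j)%:R) ->
  forall X Y, M_field X -> M_field Y -> ricci_form J g nabla e X Y x = 0.

End Geometry.

(* Main.v *)
Require Import Defs.
From HB Require Import structures.
From mathcomp Require Import all_boot all_order all_algebra complex.
From mathcomp Require Import all_classical all_reals all_analysis.
From mathcomp Require Import ring lra.
Import Order.TTheory GRing.Theory Num.Theory.
Import numFieldNormedType.Exports.

(** Why the theorem holds. The left-invariant frame given by [phi] trivialises
the tangent bundle of M, so a metric becomes a function G with values in the
positive definite matrices, and a connection becomes six matrix-valued
functions A_i. In this frame the complex structure is a constant matrix J, and
a connection that preserves it has A_i J = J A_i. So tr (J [A_i, A_j]) = 0, and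
the Ricci form is, up to a constant factor, the differential of the 1-form beta
with components beta_i = tr (A_i J): the Ricci form vanishes if and only if
beta is closed ([ricci_potential_closed]).

Total skewness of the torsion determines beta from the metric. Put H = G^-1,
let B = H J be the bivector of the fundamental form and let c_jl^k be the
structure constants. With the weight m = (det G)^(1/4) one finds
[[
   sum_j e_j (m B_jk) + 1/2 m sum_jl B_jl c_jl^k = 1/2 m (beta H)_k
]]
([bismut_divergence], [divergence_bivector]). Here m B is the bivector of a
metric conformal to the given one, weighted by its volume density, and the
identity says that beta is the obstruction for that metric to be balanced.
Two contractions follow. If beta is closed, then the vector field m B beta has
divergence 1/2 m |beta|^2 ([divergence_square]). The vector field m B e^5 has
divergence m s (H_11 + 2 H_33) + 1/2 m (beta H)_5, because the terms of
d e^5 with coefficient t are of type (2,0) + (0,2) and B is J-invariant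
([contract_de5]). If s were not 0, then adding a large multiple of the first
field to sgn(s) times the second one, and completing the square, would give a
vector field on M with positive divergence everywhere
([ricci_flat_forces_s0]). But divergences have mean zero
([no_positive_divergence]).

The mean is taken over finite sets. Let G_N be the subgroup of the points with
z^1, z^2 in (1/N) Z[i] and z^3 in (1/N^2) Z[i]. It contains Gamma, and right
translation by an element of G_N permutes the finite set Gamma\G_N, so a
difference quotient of an invariant function in the direction of such a
translation sums to exactly zero over Gamma\G_N ([grid_sum_shift]). By Taylor
and compactness difference quotients of step 1/N differ from derivatives by
O(1/N), uniformly.

Conversely, let s = 0. Then the bracket is J-linear in each argument. Take the
metric for which the frame is orthonormal, and the connection that acts on the
frame by ad_u - (ad_u)^T. It preserves the metric, it commutes with J, its
torsion is skew, and it vanishes for u in the centre, which contains all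
brackets. So its curvature is a commutator of matrices that commute with J,
and the trace against J vanishes ([inv_conn_ricci_flat]). To see this for
arbitrary vector fields one needs that their bracket is the commutator of the
derivations, that is, the symmetry of second derivatives ([derive_comm]). *)

Set Implicit Arguments.
Unset Strict Implicit.
Unset Printing Implicit Defensive.

Local Open Scope ring_scope.
Local Open Scope classical_set_scope.

(** * Smooth functions on the coordinate space *)

Section SmoothCalculus.
Variable R : realType.
Local Notation V := 'rV[R]_6.

Lemma Ck_diff (W : normedModType R) k (f : V -> W) x :
  Ck k.+1 f -> differentiable f x.
Proof. by case=> + _; exact. Qed.

Lemma Ck_derive (W : normedModType R) k (f : V -> W) v :
  Ck k.+1 f -> Ck k (fun x => 'D_v f x).
Proof. by case=> _; exact. Qed.

(** The derivatives are passed as a separate family so that closure properties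
    follow by induction on k with an explicit formula for the derivative. *)
Lemma CkS (W : normedModType R) k (f : V -> W) (f' : V -> V -> W) :
  (forall x, differentiable f x) -> (forall x v, 'D_v f x = f' v x) ->
  (forall v, Ck k (f' v)) -> Ck k.+1 f.
Proof.
by move=> df fE Cf; split=> // v; rewrite (_ : 'D_v f = f' v)//; exact/funext.
Qed.

Lemma Ck_prev (W : normedModType R) k (f : V -> W) : Ck k.+1 f -> Ck k f.
Proof.
elim: k f => [f [df _] x|k IH f [df Df]]; first exact: differentiable_continuous.
by split=> // v; exact/IH/Df.
Qed.

Lemma smooth_diff (W : normedModType R) (f : V -> W) x :
  smooth f -> differentiable f x.
Proof. by move=> /(_ 1%N) [+ _]; exact. Qed.

Lemma smooth_derivable (W : normedModType R) (f : V -> W) x v :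
  smooth f -> derivable f x v.
Proof. by move=> /smooth_diff sf; exact: diff_derivable. Qed.

Lemma smooth_cont (W : normedModType R) (f : V -> W) : smooth f -> continuous f.
Proof. by move=> /(_ 0%N). Qed.

Lemma smooth_derive (W : normedModType R) (f : V -> W) v :
  smooth f -> smooth (fun x => 'D_v f x).
Proof. by move=> sf k; case: (sf k.+1) => _; exact. Qed.

Lemma smoothS (W : normedModType R) (f : V -> W) (f' : V -> V -> W) :
  (forall x, differentiable f x) -> (forall x v, 'D_v f x = f' v x) ->
  (forall v, smooth (f' v)) -> smooth f.
Proof.
move=> df fE sf [|k]; last by apply: (CkS df fE) => v; exact: sf.
by move=> x; exact: differentiable_continuous.
Qed.

Lemma smooth_cst (W : normedModType R) (c : W) : smooth (fun _ : V => c).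
Proof.
move=> k; elim: k c => [c x|k IH c]; first exact: (@cst_continuous _ _ c).
apply: (@CkS _ _ _ (fun=> cst 0)) => [x|x v|v]; last exact: IH.
  exact: (differentiable_cst c).
exact: (derive_cst c x v).
Qed.

Lemma smooth_linear (W W' : normedModType R) (L : {linear W -> W'}) (f : V -> W) :
  continuous L -> smooth f -> smooth (fun x => L (f x)).
Proof.
move=> cL sf k; elim: k f sf => [|k IH] f sf.
  by move=> x; apply: continuous_comp; [exact: smooth_cont | exact: cL].
have dL y : differentiable L y by exact: linear_differentiable.
have dLf x : differentiable (fun x => L (f x)) x.
  by apply: differentiable_comp => //; exact: smooth_diff.
apply: (@CkS _ _ _ (fun v x => L ('D_v f x))) => [//|x v|v]; last first.
  by apply: IH; exact: smooth_derive.
rewrite deriveE// (diff_comp (smooth_diff x sf) (dL (f x))) /= diff_lin//=.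
by rewrite deriveE//; exact: smooth_diff.
Qed.

Lemma CkD (W : normedModType R) k (f g : V -> W) :
  Ck k f -> Ck k g -> Ck k (fun x => f x + g x).
Proof.
elim: k f g => [|k IH] f g Cf Cg; first by move=> x; exact: (cvgD (Cf x) (Cg x)).
have [df dg] : (forall x, differentiable f x) /\ (forall x, differentiable g x).
  by split=> x; [exact: Ck_diff Cf | exact: Ck_diff Cg].
apply: (@CkS _ _ _ (fun v x => 'D_v f x + 'D_v g x)) => [x|x v|v].
- exact: differentiableD.
- by apply: deriveD; exact: diff_derivable.
- by apply: IH; exact: Ck_derive.
Qed.

Lemma smoothD (W : normedModType R) (f g : V -> W) :
  smooth f -> smooth g -> smooth (fun x => f x + g x).
Proof. by move=> sf sg k; exact: CkD. Qed.

Lemma smoothZl (W : normedModType R) (f : V -> R) (w : W) :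
  smooth f -> smooth (fun x => f x *: w).
Proof.
move=> sf k; elim: k f sf => [|k IH] f sf;
  have dfw x : differentiable (fun x => f x *: w) x
    by apply: differentiableZl; exact: smooth_diff.
  by move=> x; exact: differentiable_continuous.
apply: (@CkS _ _ _ (fun v x => 'D_v f x *: w)) => [//|x v|v]; last first.
  by apply: IH; exact: smooth_derive.
rewrite !deriveE//; last exact: smooth_diff.
by rewrite diffZl//; exact: smooth_diff.
Qed.

Lemma CkM k (f g : V -> R) : Ck k f -> Ck k g -> Ck k (fun x => f x * g x).
Proof.
elim: k f g => [|k IH] f g Cf Cg; first by move=> x; exact: (cvgM (Cf x) (Cg x)).
have [df dg] : (forall x, differentiable f x) /\ (forall x, differentiable g x).
  by split=> x; [exact: Ck_diff Cf | exact: Ck_diff Cg].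
apply: (@CkS _ _ _ (fun v x => f x * 'D_v g x + g x * 'D_v f x)) => [x|x v|v].
- exact: differentiableM.
- by apply: deriveM; exact: diff_derivable.
- by apply: CkD; apply: IH; solve [exact: Ck_prev | exact: Ck_derive].
Qed.

Lemma smoothM (f g : V -> R) : smooth f -> smooth g -> smooth (fun x => f x * g x).
Proof. by move=> sf sg k; exact: CkM. Qed.

Lemma smoothN (f : V -> R) : smooth f -> smooth (fun x => - f x).
Proof.
move=> sf; rewrite (_ : (fun x => _) = (fun x => (-1) * f x)).
  by apply: smoothM => //; exact: smooth_cst.
by apply/funext => x; rewrite mulN1r.
Qed.

Lemma smooth_sum (W : normedModType R) (I : Type) (r : seq I) (P : pred I) (f : I -> V -> W) :
  (forall i, smooth (f i)) -> smooth (fun x => \sum_(i <- r | P i) f i x).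
Proof.
move=> sf; elim: r => [|i r IH].
  rewrite (_ : (fun x => _) = (fun=> 0)); first exact: smooth_cst.
  by apply/funext => x; rewrite big_nil.
rewrite (_ : (fun x => _) = (fun x => (if P i then f i x else 0) + \sum_(i <- r | P i) f i x)).
  by apply: smoothD => //; case: (P i) => //; exact: smooth_cst.
by apply/funext => x; rewrite big_cons; case: (P i); rewrite ?add0r.
Qed.

Lemma smooth_prod (I : Type) (r : seq I) (P : pred I) (f : I -> V -> R) :
  (forall i, smooth (f i)) -> smooth (fun x => \prod_(i <- r | P i) f i x).
Proof.
move=> sf; elim: r => [|i r IH].
  rewrite (_ : (fun x => _) = (fun=> 1)); first exact: smooth_cst.
  by apply/funext => x; rewrite big_nil.
rewrite (_ : (fun x => _) = (fun x => (if P i then f i x else 1) * \prod_(i <- r | P i) f i x)).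
  by apply: smoothM => //; case: (P i) => //; exact: smooth_cst.
by apply/funext => x; rewrite big_cons; case: (P i); rewrite ?mul1r.
Qed.

Lemma smoothV (f : V -> R) : (forall x, f x != 0) -> smooth f ->
  smooth (fun x => (f x)^-1).
Proof.
move=> f0 sf k; elim: k => [|k IH].
  by move=> x; exact: (cvgV (f0 x) (smooth_cont sf (x:=x))).
apply: (@CkS _ _ _ (fun v x => (-1 * ((f x)^-1 * (f x)^-1)) * 'D_v f x)) => [x|x v|v].
- by apply: differentiableV => //; exact: smooth_diff.
- rewrite deriveV//; last exact: smooth_derivable.
  by rewrite mulN1r -invfM -expr2.
- apply: CkM; last exact: smooth_derive.
  by apply: CkM; [exact: smooth_cst | exact: CkM].
Qed.

Lemma derive_chain (f : V -> R) (h : R -> R) (dh : R) x v :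
  differentiable f x -> is_derive (f x) 1 h dh ->
  derivable (fun y => h (f y)) x v /\ 'D_v (fun y => h (f y)) x = dh * 'D_v f x.
Proof.
move=> df [hd hE].
have dh' : differentiable h (f x) by exact/derivable1_diffP.
have dhf : differentiable (h \o f) x by exact: differentiable_comp.
split; first exact: diff_derivable dhf.
rewrite [LHS](deriveE v dhf) diff_comp//= deriveE//.
have dZ a : 'd h (f x) a = a * dh.
  rewrite -hE deriveE// -[X in 'd h _ X]mulr1 -[a * 1]/(a *: (1 : R)) linearZ.
  by [].
by rewrite dZ mulrC.
Qed.

Lemma smooth_ln (f : V -> R) : (forall x, 0 < f x) -> smooth f ->
  smooth (fun x => ln (f x)).
Proof.
move=> f0 sf.
have dl x : is_derive (f x) 1 (@ln R) (f x)^-1 by exact: is_derive1_ln.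
apply: (@smoothS _ _ (fun v x => (f x)^-1 * 'D_v f x)) => [x|x v|v].
- apply: (differentiable_comp (smooth_diff x sf)).
  by apply/derivable1_diffP; case: (dl x).
- by case: (derive_chain v (smooth_diff x sf) (dl x)).
- apply: smoothM; last exact: smooth_derive.
  by apply: smoothV => // x; rewrite gt_eqF.
Qed.

(** The derivative is the function itself times a smooth one, so the induction
    goes through at fixed f. *)
Lemma smooth_expR (f : V -> R) : smooth f -> smooth (fun x => expR (f x)).
Proof.
move=> sf k.
have dl x : is_derive (f x) 1 (@expR R) (expR (f x)) by exact: is_derive_expR.
have dif x : differentiable (fun x => expR (f x)) x.
  apply: (differentiable_comp (smooth_diff x sf)).
  by apply/derivable1_diffP; case: (dl x).
elim: k => [|k IH]; first by move=> x; exact: (differentiable_continuous (dif x)).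
apply: (@CkS _ _ _ (fun v x => expR (f x) * 'D_v f x)) => [//|x v|v].
- by case: (derive_chain v (smooth_diff x sf) (dl x)).
- by apply: CkM => //; exact: smooth_derive.
Qed.

Lemma smooth_entry m n (f : V -> 'M[R]_(m.+1, n.+1)) i j :
  smooth f -> smooth (fun x => f x i j).
Proof.
move=> sf.
pose L : 'M[R]_(m.+1, n.+1) -> R := fun A => A i j.
have Llin : linear L by move=> a A B; rewrite /L !mxE.
pose L' := GRing.isLinear.Build _ _ _ _ L Llin.
pose LL : {linear _ -> _} := HB.pack L L'.
apply: (@smooth_linear _ _ LL) => //; exact: coord_continuous.
Qed.

Lemma smooth_mx m n (f : V -> 'M[R]_(m.+1, n.+1)) :
  (forall i j, smooth (fun x => f x i j)) -> smooth f.
Proof.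
move=> sf; rewrite (_ : f = (fun x => \sum_i \sum_j f x i j *: delta_mx i j)).
  by do 2! apply: smooth_sum => ?; exact: smoothZl.
by apply/funext => x; rewrite -matrix_sum_delta.
Qed.

Lemma derive_entry m n (f : V -> 'M[R]_(m.+1, n.+1)) i j x v :
  derivable f x v -> 'D_v f x i j = 'D_v (fun x => f x i j) x.
Proof. by move=> df; rewrite derive_mx// mxE. Qed.

End SmoothCalculus.

Arguments smooth_derivable {R W f} x v.

(** * The Heisenberg group in coordinates *)

Section Heis.
Variable R : realType.
Local Notation V := 'rV[R]_6.

Lemma forall_ord6 (P : 'I_6 -> Prop) :
  P 0 -> P 1 -> P 2 -> P 3 -> P 4 -> P 5 -> forall i, P i.
Proof.
move=> P0 P1 P2 P3 P4 P5 i.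
have [] : [\/ i = 0 \/ i = 1, i = 2 \/ i = 3 | i = 4 \/ i = 5].
  case: i => -[|[|[|[|[|[|//]]]]]] hi;
  [constructor 1; left|constructor 1; right|constructor 2; left|constructor 2; right
  |constructor 3; left|constructor 3; right]; exact: val_inj.
all: by case=> ->.
Qed.

Definition row6 (a b c d e f : R) : V := \row_k [:: a; b; c; d; e; f]`_k.

Lemma row6E a b c d e f :
  (row6 a b c d e f 0 0 = a) * (row6 a b c d e f 0 1 = b) *
  (row6 a b c d e f 0 2 = c) * (row6 a b c d e f 0 3 = d) *
  (row6 a b c d e f 0 4 = e) * (row6 a b c d e f 0 5 = f).
Proof. by rewrite !mxE; do ?split. Qed.

Lemma row6_eta (x : V) : x = row6 (x 0 0) (x 0 1) (x 0 2) (x 0 3) (x 0 4) (x 0 5).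
Proof. by apply/rowP; apply: forall_ord6; rewrite row6E. Qed.

Lemma heis_mul_row6 (x y : V) : heis_mul x y =
  row6 (x 0 0 + y 0 0) (x 0 1 + y 0 1) (x 0 2 + y 0 2) (x 0 3 + y 0 3)
    (x 0 4 + y 0 4 + x 0 0 * y 0 2 - x 0 1 * y 0 3)
    (x 0 5 + y 0 5 + x 0 0 * y 0 3 + x 0 1 * y 0 2).
Proof.
apply/rowP; apply: forall_ord6; rewrite row6E /heis_mul /heis_coord !mxE /= ?mxE ?big_ord_recl ?big_ord0 ?mxE /=.
all: rewrite /=; ring.
Qed.

Lemma heis_br_row6 (u v : V) : heis_br u v =
  row6 0 0 0 0
    (u 0 0 * v 0 2 - u 0 1 * v 0 3 - (v 0 0 * u 0 2 - v 0 1 * u 0 3))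
    (u 0 0 * v 0 3 + u 0 1 * v 0 2 - (v 0 0 * u 0 3 + v 0 1 * u 0 2)).
Proof.
apply/rowP; apply: forall_ord6; rewrite row6E /heis_br /heis_coord !mxE /= ?mxE ?big_ord_recl ?big_ord0 ?mxE /=.
all: rewrite /=; ring.
Qed.

Lemma forall_ord3 (P : 'I_3 -> Prop) : P 0 -> P 1 -> P 2 -> forall i, P i.
Proof.
move=> P0 P1 P2 i; suff [->|[->|->]] : i = 0 \/ i = 1 \/ i = 2 by [].
by case: i => -[|[|[|//]]] hi;
  [left|right; left|right; right]; exact: val_inj.
Qed.

Lemma heis_inv_row6 (x : V) : heis_inv x =
  row6 (- x 0 0) (- x 0 1) (- x 0 2) (- x 0 3)
    (- x 0 4 + x 0 0 * x 0 2 - x 0 1 * x 0 3)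
    (- x 0 5 + x 0 0 * x 0 3 + x 0 1 * x 0 2).
Proof.
set y := row6 _ _ _ _ _ _.
have xy1 : heis_mx x *m heis_mx y = 1%:M.
  apply/matrixP; apply: forall_ord3; apply: forall_ord3;
  rewrite ?mxE /= ?big_ord_recl ?big_ord0 ?mxE /=
      /heis_z1 /heis_z2 /heis_z3 ?row6E; apply/eqP; rewrite eq_complex; apply/andP;
  split; apply/eqP; rewrite /=; ring.
have [xu _] := mulmx1_unit xy1.
have -> : heis_inv x = heis_coord (heis_mx y).
  by rewrite /heis_inv -[invmx _]mulmx1 -xy1 mulKmx.
by apply/rowP; apply: forall_ord6; rewrite /heis_coord row6E !mxE /= ?mxE ?row6E.
Qed.

(** The map y |-> xy is affine in these coordinates, and its linear part,
    acting on row vectors from the right, depends on x only through z^1. *)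
Definition left_mx (x : V) : 'M[R]_6 :=
  1%:M + x 0 0 *: (delta_mx 2 4 + delta_mx 3 5)
       + x 0 1 *: (delta_mx 2 5 - delta_mx 3 4).

Lemma mul_delta_row (u : V) i j : u *m (delta_mx i j : 'M[R]_6) = u 0 i *: delta_mx 0 j.
Proof.
apply/rowP => k; rewrite !mxE (bigD1 i)//= big1 ?addr0; last first.
  by move=> l li; rewrite mxE (negbTE li) mulr0.
by rewrite !mxE !eqxx.
Qed.

Lemma mul_left_mx (x u : V) : u *m left_mx x =
  row6 (u 0 0) (u 0 1) (u 0 2) (u 0 3)
    (u 0 4 + x 0 0 * u 0 2 - x 0 1 * u 0 3)
    (u 0 5 + x 0 0 * u 0 3 + x 0 1 * u 0 2).
Proof.
rewrite /left_mx !mulmxDr mulmx1 -!scalemxAr mulmxBr mulmxDr !mul_delta_row.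
apply/rowP; apply: forall_ord6; rewrite row6E !mxE /=; ring.
Qed.

Lemma heis_mulE (x y : V) : heis_mul x y = x + y *m left_mx x.
Proof.
rewrite heis_mul_row6 mul_left_mx; apply/rowP; apply: forall_ord6;
rewrite !mxE /=; ring.
Qed.

(** The order is reversed because matrices act on row vectors. *)
Lemma left_mx_mul (a x : V) : left_mx (heis_mul a x) = left_mx x *m left_mx a.
Proof.
apply/row_matrixP => i; rewrite !rowE mulmxA !mul_left_mx heis_mul_row6.
by congr row6; rewrite !row6E; ring.
Qed.

Lemma left_mx_inv (x : V) : left_mx x *m left_mx (heis_inv x) = 1%:M.
Proof.
apply/row_matrixP => i; rewrite !rowE mulmxA !mul_left_mx heis_inv_row6 mulmx1.
by rewrite [RHS]row6_eta; congr row6; rewrite !row6E; ring.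
Qed.

Lemma left_mx_invl (x : V) : left_mx (heis_inv x) *m left_mx x = 1%:M.
Proof. exact: mulmx1C (left_mx_inv x). Qed.

Lemma smooth_coord (i : 'I_6) : smooth (fun x : V => x 0 i).
Proof.
apply: smooth_entry => k; elim: k => [|k IH]; first by move=> x; exact: cvg_id.
apply: (@CkS _ _ _ _ (fun v x => v)) => [x|x v|v]; last exact: smooth_cst.
- by [].
- exact: derive_id.
Qed.

Lemma smooth_mulmx m n p (f : V -> 'M[R]_(m.+1, n.+1)) (g : V -> 'M[R]_(n.+1, p.+1)) :
  smooth f -> smooth g -> smooth (fun x => f x *m g x).
Proof.
move=> sf sg; apply: smooth_mx => i j.
rewrite (_ : (fun x => _) = (fun x => \sum_k f x i k * g x k j)).
  by apply: smooth_sum => k; apply: smoothM; exact: smooth_entry.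
by apply/funext => x; rewrite mxE.
Qed.

Lemma smooth_id : smooth (fun x : V => x).
Proof. by apply: smooth_mx => i j; rewrite (ord1 i); exact: smooth_coord. Qed.

Lemma smooth_left_mx : smooth left_mx.
Proof.
by apply: smoothD; [apply: smoothD|]; [exact: smooth_cst|..];
  apply: smoothZl; exact: smooth_coord.
Qed.

Lemma smooth_left_mx_inv : smooth (fun x => left_mx (heis_inv x)).
Proof.
rewrite (_ : (fun x : V => left_mx (heis_inv x)) = (fun x : V => 1%:M
  + (- x 0 0) *: (delta_mx 2 4 + delta_mx 3 5)
  + (- x 0 1) *: (delta_mx 2 5 - delta_mx 3 4))); last first.
  by apply/funext => x; rewrite /left_mx heis_inv_row6 !row6E.
by apply: smoothD; [apply: smoothD|]; [exact: smooth_cst|..];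
  apply: smoothZl; apply: smoothN; exact: smooth_coord.
Qed.

(** An affine change of variable turns the difference quotients of one side
    literally into those of the other. *)
Lemma derive_affine (W : normedModType R) (f : V -> W) (b v x : V) (A : 'M[R]_6) :
  'D_v (fun y => f (b + y *m A)) x = 'D_(v *m A) f (b + x *m A).
Proof.
have E : (fun h : R => h^-1 *: (((fun y => f (b + y *m A)) \o shift x) (h *: v)
    - f (b + x *m A))) =
  (fun h : R => h^-1 *: ((f \o shift (b + x *m A)) (h *: (v *m A)) - f (b + x *m A))).
  apply/funext => h; congr (_ *: (f _ - _)) => /=.
  by rewrite mulmxDl scalemxAl addrCA.
exact: (congr1 (fun F : R -> W => lim (F @ (0 : R)^')) E).
Qed.

Lemma smooth_heis_mul (x : V) : smooth (heis_mul x).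
Proof.
rewrite (_ : heis_mul x = fun y : V => x + y *m left_mx x); last exact/funext/heis_mulE.
apply: smoothD; first exact: smooth_cst.
by apply: smooth_mulmx; [exact: smooth_id | exact: smooth_cst].
Qed.

Lemma dleftE (x y u : V) : dleft x y u = u *m left_mx x.
Proof.
rewrite /dleft -deriveE; last exact: smooth_diff (smooth_heis_mul x).
rewrite (_ : heis_mul x = fun y : V => x + y *m left_mx x); last exact/funext/heis_mulE.
by rewrite (derive_affine id) derive_id.
Qed.

End Heis.

(** * Left-invariant frames *)

Section Frame.
Variable R : realType.
Local Notation V := 'rV[R]_6.

Lemma derive_mulmx m n p (f : V -> 'M[R]_(m.+1, n.+1)) (g : V -> 'M[R]_(n.+1, p.+1)) x v :
  smooth f -> smooth g ->
  'D_v (fun x => f x *m g x) x = 'D_v f x *m g x + f x *m 'D_v g x.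
Proof.
move=> sf sg; have sfg := smooth_mulmx sf sg.
have df := smooth_derivable x v sf; have dg := smooth_derivable x v sg.
apply/matrixP => i j; rewrite (derive_entry _ _ (smooth_derivable x v sfg)) !mxE.
rewrite (_ : (fun x => _) = \sum_k (fun x => f x i k * g x k j)); last first.
  by apply/funext => y; rewrite mxE fct_sumE.
have df' a b := smooth_derivable x v (smooth_entry a b sf).
have dg' a b := smooth_derivable x v (smooth_entry a b sg).
rewrite derive_sum; last by move=> k; exact: (derivableM (df' i k) (dg' k j)).
rewrite -big_split /=; apply: eq_bigr => k _.
rewrite deriveM// (derive_entry _ _ df) (derive_entry _ _ dg).
rewrite addrC; congr (_ + _); exact: mulrC.
Qed.

Lemma derive_left_mx (x v : V) : 'D_v (@left_mx R) x = left_mx v - 1%:M.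
Proof.
have Dc i : 'D_v (fun x : V => x 0 i) x = v 0 i.
  rewrite -(derive_entry (f := id)); first by rewrite derive_id.
  exact: derivable_id.
rewrite (_ : @left_mx R = fun x => 1%:M + x 0 0 *: (delta_mx 2 4 + delta_mx 3 5)
       + x 0 1 *: (delta_mx 2 5 - delta_mx 3 4))//.
have sZ (f : V -> R) (w : 'M[R]_6) : smooth f -> 'D_v (fun x => f x *: w) x = 'D_v f x *: w.
  move=> sf; have dfw : differentiable (fun x => f x *: w) x.
    by apply: differentiableZl; exact: smooth_diff.
  rewrite !deriveE//; last exact: smooth_diff.
  by rewrite diffZl//; exact: smooth_diff.
have sco i := @smooth_coord R i.
rewrite deriveD; last 2 first.
- apply: smooth_derivable; apply: smoothD; first exact: smooth_cst.
  exact: smoothZl.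
- by apply: smooth_derivable; exact: smoothZl.
rewrite deriveD; last 2 first.
- exact: derivable_cst.
- by apply: smooth_derivable; exact: smoothZl.
rewrite (derive_cst (1%:M : 'M[R]_6)) !sZ//.
by rewrite !Dc /left_mx [RHS]addrAC (addrC 1%:M) addrK add0r.
Qed.

(** Left translation by a lattice point preserves f and carries X to itself.
    *)
Lemma invariant_derive (f : V -> R) (X : V -> V) :
  (forall a x, gauss a -> f (heis_mul a x) = f x) ->
  (forall a x, gauss a -> X (heis_mul a x) = dleft a x (X x)) ->
  forall a x, gauss a ->
  'D_(X (heis_mul a x)) f (heis_mul a x) = 'D_(X x) f x.
Proof.
move=> fa Xa a x ga; rewrite Xa// dleftE heis_mulE -derive_affine.
have -> // : (fun y => f (a + y *m left_mx a)) = f.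
by apply/funext => y; rewrite -heis_mulE fa.
Qed.

Lemma derive_coord (f : V -> R) x v : smooth f ->
  'D_v f x = \sum_i v 0 i * 'D_(delta_mx 0 i) f x.
Proof.
move=> sf; have df := smooth_diff x sf.
rewrite [in LHS](row_sum_delta v) deriveE// linear_sum /=.
by apply: eq_bigr => i _; rewrite linearZ deriveE.
Qed.

Lemma M_fun_derive f (X : V -> V) : M_fun f -> M_field X ->
  M_fun (fun x => 'D_(X x) f x).
Proof.
move=> [sf fa] [sX Xa]; split; last first.
  by move=> a x ga; apply: invariant_derive.
rewrite (_ : (fun x => _) = fun x => \sum_i (X x) 0 i * 'D_(delta_mx 0 i) f x).
  apply: smooth_sum => i; apply: smoothM; last exact: smooth_derive.
  exact: smooth_entry.
by apply/funext => x; exact: derive_coord.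
Qed.

(** J is written as a difference K - K^T, which makes its skewness immediate.
    *)
Definition Jhalf : 'M[R]_6 := delta_mx 0 1 + delta_mx 2 3 + delta_mx 4 5.
Definition Jmx : 'M[R]_6 := Jhalf - Jhalf^T.

Lemma gst_JE (u : V) : gst_J u = u *m Jmx.
Proof.
have -> : Jmx = Jhalf - (delta_mx 1 0 + delta_mx 3 2 + delta_mx 5 4).
  by rewrite /Jmx {2}/Jhalf !linearD /= !trmx_delta.
rewrite mulmxBr !mulmxDr !mul_delta_row.
by apply/rowP; apply: forall_ord6; rewrite !mxE /=; ring.
Qed.

Lemma Jmx_sqr : Jmx *m Jmx = - 1%:M.
Proof.
apply/row_matrixP => i; rewrite !rowE mulmxA -!gst_JE mulmxN mulmx1.
by apply/rowP; apply: forall_ord6; rewrite !mxE /= ?opprK.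
Qed.

Lemma Jmx_tr : Jmx^T = - Jmx.
Proof. by rewrite /Jmx linearB /= trmxK opprB. Qed.

Lemma gst_br_row6 (s t : R) (u v : V) :
  gst_br s t u v = row6 0 0 0 0 (- de5 s t u v) (- de6 t u v).
Proof. by []. Qed.

Lemma gst_br_bilin s t : (forall a (u u' v : V),
   gst_br s t (a *: u + u') v = a *: gst_br s t u v + gst_br s t u' v) /\
 (forall a (u v v' : V),
   gst_br s t u (a *: v + v') = a *: gst_br s t u v + gst_br s t u v').
Proof.
by split=> a u v w; apply/rowP; apply: forall_ord6;
   rewrite !mxE /= ?/de5 ?/de6 /wedge ?mxE; ring.
Qed.

Section Phi.
Variables (s t : R) (phi : 'M[R]_6).
Hypothesis iso : lie_iso s t phi.

Let phiu : phi \in unitmx. Proof. by case: iso. Qed.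

(** The left-invariant field whose value at the identity corresponds to [u]
    under the isomorphism with g_{s,t}. *)
Definition frame (u x : V) : V := u *m phi *m left_mx x.
Definition coframe (X : V -> V) (x : V) : V := X x *m left_mx (heis_inv x) *m invmx phi.

Lemma frameK y x : coframe (fun x => frame (y x) x) x = y x.
Proof. by rewrite /coframe /frame -(mulmxA _ (left_mx x)) left_mx_inv mulmx1 mulmxK. Qed.

Lemma coframeK X x : frame (coframe X x) x = X x.
Proof. by rewrite /coframe /frame mulmxKV// -mulmxA left_mx_invl mulmx1. Qed.

Lemma frame_linear a u v x : frame (a *: u + v) x = a *: frame u x + frame v x.
Proof. by rewrite /frame !mulmxDl -!scalemxAl. Qed.

(** Coefficient functions, in a left-invariant frame, of vector fields on M.
    *)
Definition Gamma_invariant (y : V -> V) :=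
  smooth y /\ forall a x, gauss a -> y (heis_mul a x) = y x.

Lemma frame_field y : Gamma_invariant y -> M_field (fun x => frame (y x) x).
Proof.
move=> [sy ya]; split.
  apply: smooth_mulmx; last exact: smooth_left_mx.
  by apply: smooth_mulmx => //; exact: smooth_cst.
by move=> a x ga; rewrite dleftE /frame ya// left_mx_mul !mulmxA.
Qed.

Lemma coframe_inv X : M_field X -> Gamma_invariant (coframe X).
Proof.
move=> [sX Xa]; split.
  apply: smooth_mulmx; last exact: smooth_cst.
  by apply: smooth_mulmx => //; exact: smooth_left_mx_inv.
move=> a x ga; rewrite /coframe (Xa a x ga) dleftE.
suff -> : X x *m left_mx a *m left_mx (heis_inv (heis_mul a x)) = X x *m left_mx (heis_inv x).
  by [].
have {1}-> : X x = X x *m left_mx (heis_inv x) *m left_mx x.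
  by rewrite -mulmxA left_mx_invl mulmx1.
by rewrite -(mulmxA _ (left_mx x)) -left_mx_mul -mulmxA left_mx_inv mulmx1.
Qed.

Lemma frame_cst_field u : M_field (frame u).
Proof. by apply: (@frame_field (fun=> u)); split=> //; exact: smooth_cst. Qed.

Lemma Jphi_frame u x : Jphi phi x (frame u x) = frame (u *m Jmx) x.
Proof.
rewrite /Jphi !dleftE /frame -(mulmxA _ (left_mx x)) left_mx_inv mulmx1 mulmxK//.
by rewrite gst_JE.
Qed.

Lemma heis_br_left_mx (u v x : V) : heis_br u v *m left_mx x = heis_br u v.
Proof. by rewrite mul_left_mx heis_br_row6 !row6E !mulr0 !addr0 subr0. Qed.

Lemma heis_br_left_mxE (u v : V) : v *m (left_mx u - 1%:M) - u *m (left_mx v - 1%:M) = heis_br u v.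
Proof.
rewrite !mulmxBr !mulmx1 !mul_left_mx heis_br_row6.
apply/rowP; apply: forall_ord6; rewrite !mxE /=; ring.
Qed.

(** Leibniz rule: the coefficients are differentiated, and what remains is the
    bracket of left-invariant fields. The differential of left translation is
    affine in the base point, so that bracket is a difference of two explicit
    products, which is the matrix commutator. *)
Lemma field_br_frame (y z : V -> V) x : smooth y -> smooth z ->
  field_br (fun x => frame (y x) x) (fun x => frame (z x) x) x =
  frame ('D_(frame (y x) x) z x - 'D_(frame (z x) x) y x + gst_br s t (y x) (z x)) x.
Proof.
move=> sy sz; rewrite /field_br.
have D (w : V -> V) v : smooth w -> 'D_v (fun x => frame (w x) x) x =
    frame ('D_v w x) x + w x *m phi *m (left_mx v - 1%:M).
  move=> sw; rewrite /frame derive_mulmx; last 2 first.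
  - by apply: smooth_mulmx => //; exact: smooth_cst.
  - exact: smooth_left_mx.
  rewrite derive_left_mx derive_mulmx//; last exact: smooth_cst.
  by rewrite (derive_cst phi) mulmx0 addr0.
have tE (w w' : V) : w *m (left_mx (frame w' x) - 1%:M) = w *m (left_mx (w' *m phi) - 1%:M).
  by rewrite /left_mx /frame !mul_left_mx !row6E.
rewrite (D z _ sz).
rewrite (D y _ sy).
rewrite (tE (z x *m phi) (y x)).
rewrite (tE (y x *m phi) (z x)).
rewrite opprD addrACA heis_br_left_mxE iso.2.
have := heis_br_left_mx (y x *m phi) (z x *m phi) x.
rewrite iso.2 => E.
rewrite -{}E.
rewrite /frame !mulmxDl.
by rewrite !mulNmx.
Qed.

Lemma field_br_cst u v : field_br (frame u) (frame v) = frame (gst_br s t u v).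
Proof.
apply/funext => x; rewrite (@field_br_frame (fun=> u) (fun=> v)); try exact: smooth_cst.
by rewrite !(derive_cst (_ : V)) subr0 add0r.
Qed.

End Phi.
End Frame.

(** * Mean values along lines and symmetry of second derivatives *)

Section Line.
Variable R : realType.
Local Notation V := 'rV[R]_6.

Lemma is_derive_line (f : V -> R) (x v : V) (h : R) : smooth f ->
  is_derive h 1 (fun k : R => f (x + k *: v)) ('D_v f (x + h *: v)).
Proof.
move=> sf.
have E : (fun k : R => k^-1 *: (((fun k => f (x + k *: v)) \o shift h) (k *: 1)
    - f (x + h *: v))) =
  (fun k : R => k^-1 *: ((f \o shift (x + h *: v)) (k *: v) - f (x + h *: v))).
  apply/funext => k; congr (_ *: (f _ - _)) => /=.
  by rewrite /= -[k *: 1]/(k * 1) mulr1 scalerDl addrCA.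
split; first by rewrite /derivable E; exact: (smooth_derivable _ _ sf).
exact: (congr1 (fun F : R -> R => lim (F @ (0 : R)^')) E).
Qed.

Lemma MVT_line (f : V -> R) (x v : V) (h : R) : smooth f -> 0 <= h ->
  exists2 c, 0 <= c <= h & f (x + h *: v) - f x = h * 'D_v f (x + c *: v).
Proof.
move=> sf h0.
have dl k := is_derive_line x v k sf.
have dk k : k \in `]0, h[%R -> is_derive k 1 (fun k => f (x + k *: v)) ('D_v f (x + k *: v)).
  by move=> _; exact: dl.
have ck : {within `[0, h], continuous (fun k => f (x + k *: v))}.
  apply: continuous_subspaceT => k; apply: differentiable_continuous.
  by apply/derivable1_diffP; case: (dl k).
have [c] := MVT_segment h0 dk ck.
rewrite in_itv /= => ch; rewrite scale0r addr0 subr0 => E.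
by exists c => //; rewrite E mulrC.
Qed.

End Line.

Section Schwarz.
Variable R : realType.
Local Notation V := 'rV[R]_6.

(** Mean value theorem, once in each direction. The left-hand side is
    symmetric under exchange of u and v, the right-hand side is not: this
    gives the symmetry of second derivatives. *)
Lemma second_difference (f : V -> R) (x u v : V) (h : R) : smooth f -> 0 <= h ->
  exists2 c, 0 <= c.1 <= h /\ 0 <= c.2 <= h &
  f (x + h *: u + h *: v) - f (x + h *: u) - (f (x + h *: v) - f x) =
  h ^+ 2 * 'D_v (fun y => 'D_u f y) (x + c.1 *: u + c.2 *: v).
Proof.
move=> sf h0; pose q k := f (x + h *: v + k *: u) - f (x + k *: u).
pose q' k := 'D_u f (x + h *: v + k *: u) - 'D_u f (x + k *: u).
have dq (k : R) : is_derive k 1 q (q' k).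
  exact: (is_deriveB (is_derive_line (x + h *: v) u k sf) (is_derive_line x u k sf)).
have dk (k : R) : k \in `]0, h[%R -> is_derive k 1 q (q' k) by move=> _; exact: dq.
have ck : {within `[0, h], continuous q}.
  apply: continuous_subspaceT => k; apply: differentiable_continuous.
  by apply/derivable1_diffP; case: (dq k).
have [c] := MVT_segment h0 dk ck; rewrite in_itv /= => ch E.
have [e eh E'] := MVT_line (x + c *: u) v (smooth_derive u sf) h0.
exists (c, e) => //=; rewrite expr2 -mulrA -E'.
have -> : x + c *: u + h *: v = x + h *: v + c *: u by rewrite addrAC.
rewrite -/(q' c) subr0 in E *; rewrite [RHS]mulrC -E /q !scale0r !addr0.
by rewrite [x + h *: v + _]addrAC.
Qed.

Lemma continuous_norm (p : V -> R) (x : V) (e : R) : continuous p -> 0 < e ->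
  exists2 d, 0 < d & forall y, `|y| < d -> `|p (x + y) - p x| < e.
Proof.
move=> cp e0; have /cvgrPdist_lt /(_ e e0) := cp x.
move=> /nbhs_ballP[d d0 bd]; exists d => // y yd.
rewrite distrC; apply: bd; rewrite /= -ball_normE /ball_ /=.
by rewrite opprD addrA subrr sub0r normrN.
Qed.

(** Both orders of differentiation compute the same second difference at
    points close to x, and both second derivatives are continuous. *)
Lemma derive_comm (f : V -> R) (x u v : V) : smooth f ->
  'D_u (fun y => 'D_v f y) x = 'D_v (fun y => 'D_u f y) x.
Proof.
move=> sf; pose p y := 'D_v (fun y => 'D_u f y) y; pose q y := 'D_u (fun y => 'D_v f y) y.
have cp : continuous p by apply: smooth_cont; do 2!apply: smooth_derive.
have cq : continuous q by apply: smooth_cont; do 2!apply: smooth_derive.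
apply/eqP; rewrite -subr_eq0 -normr_eq0 eq_le normr_ge0 andbT.
apply/ler_addgt0Pl => e e0; rewrite addr0.
have e2 : 0 < e / 2 by rewrite divr_gt0.
have [d1 d10 Hd1] := continuous_norm x cp e2.
have [d2 d20 Hd2] := continuous_norm x cq e2.
pose d := Num.min d1 d2; have d0 : 0 < d by rewrite lt_min d10.
pose N := `|u| + `|v| + 1.
have N0 : 0 < N by rewrite ltr_wpDl ?addr_ge0.
(* All points at which the derivatives are evaluated are within h (|u| + |v|)
   of x, which is less than d. *)
pose h := d / N; have h0 : 0 < h by rewrite divr_gt0.
have small a b : 0 <= a <= h -> 0 <= b <= h -> `|a *: u + b *: v| < d.
  move=> /andP[a0 ah] /andP[b0 bh].
  apply: (@le_lt_trans _ _ (h * (`|u| + `|v|))).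
    apply: le_trans (ler_normD _ _) _; rewrite !normrZ !ger0_norm// mulrDr.
    by apply: lerD; apply: ler_wpM2r.
  by rewrite /h -mulrA gtr_pMr// mulrC ltr_pdivrMr// mul1r /N ltrDl.
have [[a b] [ha hb] E1] := second_difference x u v sf (ltW h0).
have [[a' b'] [ha' hb'] E2] := second_difference x v u sf (ltW h0).
have {}E1 : f (x + h *: u + h *: v) - f (x + h *: u) - (f (x + h *: v) - f x) =
  h ^+ 2 * p (x + a *: u + b *: v) := E1.
have {}E2 : f (x + h *: v + h *: u) - f (x + h *: v) - (f (x + h *: u) - f x) =
  h ^+ 2 * q (x + a' *: v + b' *: u) := E2.
have pq : p (x + a *: u + b *: v) = q (x + a' *: v + b' *: u).
  apply: (@mulfI _ (h ^+ 2)); first by rewrite expf_neq0// gt_eqF.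
  apply: etrans (esym E1) (etrans _ E2).
  have -> : x + h *: u + h *: v = x + h *: v + h *: u by exact: addrAC.
  have sub4 (k l m n : R) : k - l - (m - n) = k - m - (l - n) by ring.
  exact: sub4.
have P1 : `|p (x + a *: u + b *: v) - p x| < e / 2.
  rewrite -addrA; apply: Hd1; apply: lt_le_trans (small _ _ ha hb) _.
  by rewrite ge_min lexx.
have P2 : `|q (x + a' *: v + b' *: u) - q x| < e / 2.
  rewrite -addrA [a' *: _ + _]addrC; apply: Hd2.
  by apply: lt_le_trans (small _ _ hb' ha') _; rewrite ge_min lexx orbT.
have fin (r a0 b0 : R) : `|r - b0| < e / 2 -> `|r - a0| < e / 2 -> `|a0 - b0| <= e.
  move=> rb ra; have -> : a0 - b0 = (r - b0) - (r - a0) by ring.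
  apply: le_trans (ler_normB _ _) _; apply: ltW.
  by rewrite [e]splitr; exact: ltrD.
have P3 : `|q (x + a' *: v + b' *: u) - p x| < e / 2 by rewrite -pq.
exact: (fin _ (q x) (p x) P3 P2).
Qed.

End Schwarz.

(** * Orthonormal bases, determinants and inverses of matrix-valued functions *)

(** Induction on the size: the first basis vector is normalised, and the rest
    is replaced by its Schur complement, which is again positive definite. *)
Lemma orthonormal_basis (R : rcfType) n (G : 'M[R]_n) : G^T = G ->
  (forall u : 'rV[R]_n, u != 0 -> 0 < (u *m G *m u^T) 0 0) ->
  exists O : 'M[R]_n, O *m G *m O^T = 1%:M.
Proof.
elim: n G => [|n IH] G Gs Gp; first by exists 0; apply/matrixP => -[].
pose M : 'M[R]_(1 + n) := G; pose a := ulsubmx M; pose b := ursubmx M.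
pose C := drsubmx M.
have Ms : M^T = M by exact: Gs.
have ds : dlsubmx M = b^T by rewrite /b -[in RHS]Ms -trmx_dlsub trmxK.
have Cs : C^T = C by rewrite /C -[in RHS]Ms -trmx_drsub.
have ME : M = block_mx a b b^T C by rewrite -ds submxK.
pose al := a 0 0.
have aE : a = al%:M by rewrite [LHS]mx11_scalar.
have Mp (u : 'rV[R]_(1 + n)) : u != 0 -> 0 < (u *m M *m u^T) 0 0 by exact: Gp.
have al0 : 0 < al.
  have := Mp (row_mx 1%:M 0); rewrite ME mul_row_block tr_row_mx mul_row_col.
  rewrite !mul1mx !mul0mx !addr0 trmx1 trmx0 mulmx1 mulmx0 addr0; apply.
  apply/eqP => /(congr1 (fun r => lsubmx r 0 0)); rewrite row_mxKl !mxE /=.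
  by move/eqP; rewrite oner_eq0.
pose E : 'M[R]_(1 + n) := block_mx 1%:M 0 (- (al^-1 *: b^T)) 1%:M.
pose C' := C - al^-1 *: (b^T *m b).
have EME : E *m M *m E^T = block_mx al%:M 0 0 C'.
  rewrite ME /E tr_block_mx !mulmx_block !(mul1mx, mul0mx, mulmx1, mulmx0, addr0, trmx1, trmx0).
  have al_neq0 : al != 0 by rewrite gt_eqF.
  have E1 : - (al^-1 *: b^T) *m al%:M + b^T = 0.
    by rewrite mul_mx_scalar scalerN scalerA mulfV// scale1r addNr.
  have E2 : al%:M *m (- (al^-1 *: b^T))^T + b = 0.
    rewrite linearN linearZ /= trmxK mul_scalar_mx scalerN scalerA mulfV//.
    by rewrite scale1r addNr.
  by rewrite aE E1 E2 mul0mx add0r mulNmx -scalemxAl addrC.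
have C's : C'^T = C'.
  by rewrite /C' linearB /= linearZ /= trmx_mul trmxK Cs.
have [|O' O'E] := IH C' C's.
  move=> u u0; pose v : 'rV[R]_(1 + n) := row_mx 0 u *m E.
  have <- : v *m M *m v^T = u *m C' *m u^T.
    have -> : v *m M *m v^T = row_mx 0 u *m (E *m M *m E^T) *m (row_mx 0 u)^T.
      by rewrite /v trmx_mul !mulmxA.
    rewrite EME mul_row_block tr_row_mx mul_row_col.
    by rewrite !(mul0mx, mulmx0, add0r, addr0, trmx0).
  apply: Mp; rewrite /v /E mul_row_block !mul0mx mulmx1 !add0r.
  by apply: contra_neq u0 => /(congr1 rsubmx); rewrite row_mxKr linear0.
pose s := (Num.sqrt al)^-1.
pose O : 'M[R]_(1 + n) := block_mx s%:M 0 0 O' *m E.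
exists (O : 'M[R]_n.+1).
have : O *m M *m O^T = 1%:M; last by [].
rewrite /O trmx_mul !mulmxA -(mulmxA _ E) -(mulmxA _ (E *m M)) EME tr_block_mx.
rewrite !mulmx_block !(mul0mx, mulmx0, addr0, add0r, trmx0) O'E tr_scalar_mx.
rewrite -!scalar_mxM (_ : s * al * s = 1) -?scalar_mx_block//.
rewrite mulrAC -expr2 /s exprVn sqr_sqrtr ?mulVf ?gt_eqF//; exact: ltW.
Qed.

Section DetCalculus.
Variable R : realType.
Local Notation V := 'rV[R]_6.

Lemma smooth_det n (F : V -> 'M[R]_n) : (forall i j, smooth (fun x => F x i j)) ->
  smooth (fun x => \det (F x)).
Proof.
move=> sF; rewrite /determinant; apply: smooth_sum => s.
by apply: smoothM; [exact: smooth_cst | exact: smooth_prod].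
Qed.

Lemma derive_sum_fun (I : finType) (f : I -> V -> R) x v :
  (forall i, smooth (f i)) ->
  'D_v (fun x => \sum_i f i x) x = \sum_i 'D_v (f i) x.
Proof.
move=> sf; suff [] : derivable (fun x => \sum_i f i x) x v /\ 'D_v (fun x => \sum_i f i x) x = \sum_i 'D_v (f i) x by [].
elim: (index_enum I) => [|i r [IHd IH]].
  rewrite big_nil (_ : (fun x => _) = cst 0); last by apply/funext => y; rewrite big_nil.
  by rewrite derive_cst; split => //; exact: derivable_cst.
rewrite big_cons (_ : (fun x => _) = f i \+ (fun x => \sum_(j <- r) f j x)); last first.
  by apply/funext => y; rewrite big_cons.
have di := smooth_derivable x v (sf i).
split; first exact: (derivableD di IHd).
by rewrite -IH; exact: (deriveD di IHd).
Qed.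

Lemma derive_mul (f g : V -> R) x v : smooth f -> smooth g ->
  'D_v (fun x => f x * g x) x = 'D_v f x * g x + f x * 'D_v g x.
Proof.
move=> sf sg; rewrite (deriveM (smooth_derivable x v sf) (smooth_derivable x v sg)).
by rewrite addrC; congr (_ + _); exact: mulrC.
Qed.

Lemma derive_prod n (f : 'I_n -> V -> R) x v : (forall i, smooth (f i)) ->
  'D_v (fun x => \prod_i f i x) x =
  \sum_k \prod_i (if i == k then 'D_v (f i) x else f i x).
Proof.
elim: n f => [|n IH] f sf.
  rewrite big_ord0 (_ : (fun x => _) = cst 1); last by apply/funext => y; rewrite big_ord0.
  exact: derive_cst.
rewrite (_ : (fun x => _) = (fun x => f ord0 x * \prod_(i < n) f (lift ord0 i) x)); last first.
  by apply/funext => y; rewrite big_ord_recl.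
rewrite derive_mul//; last exact: smooth_prod.
rewrite big_ord_recl big_ord_recl eqxx; congr (_ * _ + _).
rewrite IH// mulr_sumr; apply: eq_bigr => k _.
rewrite big_ord_recl (negbTE (neq_lift _ _)); congr (_ * _).
Qed.

(** Jacobi's formula. The product rule differentiates one row at a time, and a
    determinant with one row replaced is expanded along that row. *)
Lemma derive_det n (F : V -> 'M[R]_n) x v : (forall i j, smooth (fun x => F x i j)) ->
  'D_v (fun x => \det (F x)) x =
  \tr (\adj (F x) *m \matrix_(i, j) 'D_v (fun x => F x i j) x).
Proof.
move=> sF; rewrite /determinant derive_sum_fun; last first.
  by move=> s; apply: smoothM; [exact: smooth_cst | exact: smooth_prod].
under eq_bigr => s _.
  rewrite derive_mul; [|exact: smooth_cst|exact: smooth_prod].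
  rewrite (derive_cst ((-1) ^+ perm.odd_perm s : R)) mul0r add0r derive_prod// mulr_sumr.
  over.
rewrite exchange_big /= mxtrace_mulC; apply: eq_bigr => k _.
pose M := \matrix_(i, j) (if i == k then 'D_v (fun x => F x i j) x else F x i j).
transitivity (\det M).
  by apply: eq_bigr => s _; congr (_ * _); apply: eq_bigr => i _; rewrite mxE.
rewrite (expand_det_row M k) mxE; apply: eq_bigr => j _.
rewrite !mxE eqxx; congr (_ * _); rewrite /cofactor; congr (_ * \det _).
by apply/matrixP => i l; rewrite !mxE eq_sym (negbTE (neq_lift _ _)).
Qed.

Lemma smooth_invmx n (F : V -> 'M[R]_n.+1) : smooth F -> (forall x, F x \in unitmx) ->
  smooth (fun x => invmx (F x)).
Proof.
move=> sF Fu; have sF' i j := smooth_entry i j sF.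
rewrite (_ : (fun x => _) = (fun x => (\det (F x))^-1 *: \adj (F x))); last first.
  by apply/funext => x; rewrite /invmx Fu.
apply: smooth_mx => i j.
rewrite (_ : (fun x => _) = (fun x => (\det (F x))^-1 * cofactor (F x) j i)); last first.
  by apply/funext => x; rewrite !mxE.
apply: smoothM.
  apply: smoothV; last exact: smooth_det.
  by move=> x; have := Fu x; rewrite unitmxE unitfE.
rewrite /cofactor; apply: smoothM; first exact: smooth_cst.
apply: smooth_det => k l.
rewrite (_ : (fun x => _) = (fun x => F x (lift j k) (lift i l))) //.
by apply/funext => x; rewrite !mxE.
Qed.

Lemma derive_invmx (F H : V -> 'M[R]_6) x v : smooth F -> smooth H ->
  (forall x, F x *m H x = 1%:M) -> 'D_v H x = - (H x *m 'D_v F x *m H x).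
Proof.
move=> sF sH FH; have HF := mulmx1C (FH x).
have : 'D_v (fun x => F x *m H x) x = 0.
  rewrite (_ : (fun x => _) = cst 1%:M); last exact/funext.
  exact: derive_cst.
rewrite derive_mulmx// => /eqP; rewrite addrC addr_eq0 => /eqP E.
transitivity (H x *m (F x *m 'D_v H x)); first by rewrite mulmxA HF mul1mx.
by rewrite E mulmxN mulmxA.
Qed.

End DetCalculus.

(** * Lie brackets of vector fields as commutators of derivations *)

Section Commutator.
Variable R : realType.
Local Notation V := 'rV[R]_6.
Local Notation e_ := (delta_mx 0 : 'I_6 -> V).

(** The part with second derivatives is the Hessian of f contracted with Y and
    w. *)
Lemma derive_along (f : V -> R) (Y : V -> V) x w : smooth f -> smooth Y ->
  'D_w (fun p => 'D_(Y p) f p) x =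
  'D_('D_w Y x) f x + \sum_i \sum_j Y x 0 i * (w 0 j * 'D_(e_ j) (fun p => 'D_(e_ i) f p) x).
Proof.
move=> sf sY; have sYi i : smooth (fun p => Y p 0 i) := smooth_entry 0 i sY.
have sD i : smooth (fun p => 'D_(e_ i) f p) := smooth_derive (e_ i) sf.
have -> : (fun p => 'D_(Y p) f p) = fun p => \sum_i Y p 0 i * 'D_(e_ i) f p.
  by apply/funext => p; exact: derive_coord.
rewrite (derive_sum_fun _ _ (fun i => smoothM (sYi i) (sD i))).
rewrite (derive_coord x ('D_w Y x) sf) -big_split /=; apply: eq_bigr => i _.
rewrite (derive_mul x w (sYi i) (sD i)); congr (_ * _ + _).
  by rewrite (derive_entry 0 i (smooth_derivable x w sY)).
by rewrite (derive_coord x w (sD i)) mulr_sumr.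
Qed.

(** The Hessians cancel by symmetry of second derivatives. *)
Lemma derive_field_br (f : V -> R) (X Y : V -> V) x : smooth f -> smooth X -> smooth Y ->
  'D_(X x) (fun p => 'D_(Y p) f p) x - 'D_(Y x) (fun p => 'D_(X p) f p) x
  = 'D_(field_br X Y x) f x.
Proof.
move=> sf sX sY; rewrite !derive_along//.
have -> : \sum_i \sum_j Y x 0 i * (X x 0 j * 'D_(e_ j) (fun p => 'D_(e_ i) f p) x) =
    \sum_i \sum_j X x 0 i * (Y x 0 j * 'D_(e_ j) (fun p => 'D_(e_ i) f p) x).
  rewrite exchange_big /=; apply: eq_bigr => i _; apply: eq_bigr => j _.
  by rewrite (derive_comm x (e_ i) (e_ j) sf) mulrCA.
have gen (a b c : R) : a + c - (b + c) = a - b by ring.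
apply: etrans (gen _ _ _) _; rewrite /field_br.
by rewrite !(deriveE _ (smooth_diff x sf)) linearB.
Qed.

Lemma derive_field_br_row (z : V -> V) (X Y : V -> V) x : smooth z -> smooth X -> smooth Y ->
  'D_(X x) (fun p => 'D_(Y p) z p) x - 'D_(Y x) (fun p => 'D_(X p) z p) x
  = 'D_(field_br X Y x) z x.
Proof.
move=> sz sX sY.
have along (U : V -> V) : smooth U -> smooth (fun p => 'D_(U p) z p).
  move=> sU; apply: smooth_mx => i k.
  have szk : smooth (fun p => z p i k) := smooth_entry i k sz.
  rewrite (_ : (fun p => _) = fun p => \sum_j U p 0 j * 'D_(e_ j) (fun p => z p i k) p).
    apply: smooth_sum => j; apply: smoothM; first exact: smooth_entry.
    exact: smooth_derive.
  apply/funext => p; rewrite (derive_entry i k (smooth_derivable p (U p) sz)).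
  exact: derive_coord.
have ent (U : V -> V) i k : (fun p => ('D_(U p) z p) i k) = (fun p => 'D_(U p) (fun p => z p i k) p).
  by apply/funext => p; rewrite (derive_entry i k (smooth_derivable p (U p) sz)).
apply/matrixP => i k.
have E1 (A B : V -> V) : smooth B -> ('D_(A x) (fun p => 'D_(B p) z p) x) i k =
    'D_(A x) (fun p => 'D_(B p) (fun p => z p i k) p) x.
  move=> sB; rewrite -(ent B i k).
  exact: (derive_entry i k (smooth_derivable x (A x) (along B sB))).
have E2 := derive_entry i k (smooth_derivable x (field_br X Y x) sz).
have sum_entry (M N : V) : (M - N) i k = M i k - N i k by rewrite !mxE.
apply: etrans (sum_entry _ _) (etrans _ (esym E2)).
apply: etrans (congr2 (fun a b : R => a - b) (E1 X Y sY) (E1 Y X sX)) _.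
exact: (derive_field_br x (smooth_entry i k sz) sX sY).
Qed.

End Commutator.

(** * Divergences of invariant fields have mean zero *)

Section Grid.
Variable R : realType.

Definition int_sum (M : nat) (f : int -> R) : R := \sum_(k < M) f k%:Z.

Lemma int_sum_shift1 M (f : int -> R) : (forall k, f (k + M%:Z) = f k) ->
  int_sum M (fun k => f (k + 1)) = int_sum M f.
Proof.
case: M => [|M] fM; first by rewrite /int_sum !big_ord0.
rewrite /int_sum big_ord_recr big_ord_recl /= addrC; congr (_ + _).
  by rewrite -[RHS]fM add0r intS addrC.
by apply: eq_bigr => k _; rewrite /bump /= add1n -addn1 PoszD.
Qed.

Lemma int_sum_shift M (f : int -> R) r : (forall k, f (k + M%:Z) = f k) ->
  int_sum M (fun k => f (k + r)) = int_sum M f.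
Proof.
move=> fM.
have P (g : int -> R) n : (forall k, g (k + M%:Z) = g k) ->
    int_sum M (fun k => g (k + n%:Z)) = int_sum M g.
  move=> gM; elim: n => [|n IH].
    by congr (int_sum M _); apply/funext => k; rewrite addr0.
  rewrite -IH -[RHS]int_sum_shift1; last by move=> k; rewrite addrAC gM.
  by congr (int_sum M _); apply/funext => k; rewrite intS addrA.
case: (intP r) => [|n|n]; [exact: (P f 0%N)|exact: P|].
rewrite -(P (fun k => f (k - n.+1%:Z)) n.+1); last by move=> k; rewrite addrAC fM.
by congr (int_sum M _); apply/funext => k; rewrite addrK.
Qed.

Lemma int_sum_sum M (I : Type) (s : seq I) (F : I -> int -> R) :
  int_sum M (fun k => \sum_(i <- s) F i k) = \sum_(i <- s) int_sum M (F i).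
Proof. exact: exchange_big. Qed.

Lemma int_sum_sub M (F G : int -> R) :
  int_sum M (fun k => F k - G k) = int_sum M F - int_sum M G.
Proof. by rewrite /int_sum big_split /= sumrN. Qed.

Lemma int_sum_gt0 M (F : int -> R) : (0 < M)%N -> (forall k, 0 < F k) -> 0 < int_sum M F.
Proof.
case: M => // M _ F0; rewrite /int_sum big_ord_recl; apply: ltr_pwDl => //.
by apply: sumr_ge0 => i _; exact: ltW.
Qed.

End Grid.

Section Divergence.
Variable R : realType.
Local Notation V := 'rV[R]_6.

Lemma gauss_row6 (a b c d e h : int) :
  gauss (row6 a%:~R b%:~R c%:~R d%:~R e%:~R h%:~R : V).
Proof. by apply: forall_ord6; rewrite row6E; exact: intr_int. Qed.

Definition unit_box := [set x : V | forall i, `[0 : R, 1]%classic (x 0 i)].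

(** z^1 and z^2 are reduced first; z^3 is translated by them, so its integer
    part is taken after that. *)
Lemma gauss_reduce (x : V) : exists2 a, gauss a & unit_box (heis_mul a x).
Proof.
pose fl (r : R) : int := - Num.floor r.
have flP r : 0 <= (fl r)%:~R + r <= 1.
  have := floor_itv r; rewrite /fl rmorphN /= rmorphD /=; lra.
pose a := fl (x 0 0); pose b := fl (x 0 1); pose c := fl (x 0 2); pose d := fl (x 0 3).
pose e := fl (x 0 4 + a%:~R * x 0 2 - b%:~R * x 0 3).
pose h := fl (x 0 5 + a%:~R * x 0 3 + b%:~R * x 0 2).
exists (row6 a%:~R b%:~R c%:~R d%:~R e%:~R h%:~R); first exact: gauss_row6.
by apply: forall_ord6; rewrite heis_mul_row6 !row6E /= in_itv /=;
  rewrite -?addrA; (exact: flP || (rewrite !addrA; have := flP (x 0 4 + a%:~R * x 0 2 - b%:~R * x 0 3);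
   have := flP (x 0 5 + a%:~R * x 0 3 + b%:~R * x 0 2); rewrite -/e -/h; lra)).
Qed.

Lemma compact_unit_box : compact unit_box.
Proof. exact: (rV_compact (A := fun=> `[0 : R, 1]%classic)) (fun=> segment_compact (a:=0) (b:=1)). Qed.

Lemma unit_box_neq0 : unit_box !=set0.
Proof. by exists 0 => i; rewrite mxE /= in_itv /= lexx ler01. Qed.

Lemma invariant_bounded (f : V -> R) : continuous f ->
  (forall a x, gauss a -> f (heis_mul a x) = f x) -> exists C, forall x, f x <= C.
Proof.
move=> cf fa.
have [c _ fc] := EVT_max_rV unit_box_neq0 compact_unit_box (continuous_subspaceT cf).
exists (f c) => x; have [a ga bx] := gauss_reduce x.
by rewrite -(fa a x ga); apply: fc; rewrite inE.
Qed.

Lemma invariant_pos (f : V -> R) : continuous f ->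
  (forall a x, gauss a -> f (heis_mul a x) = f x) -> (forall x, 0 < f x) ->
  exists2 C, 0 < C & forall x, C <= f x.
Proof.
move=> cf fa f0.
have [c _ fc] := EVT_min_rV unit_box_neq0 compact_unit_box (continuous_subspaceT cf).
exists (f c) => // x; have [a ga bx] := gauss_reduce x.
by rewrite -(fa a x ga); apply: fc; rewrite inE.
Qed.

(** Left-invariant: the image of the k-th basis vector under the differential
    of left translation by x. *)
Definition coord_frame (k : 'I_6) (x : V) : V := delta_mx 0 k *m left_mx x.

(** The coefficients of these fields involve z^1 only, and only in the fields
    that do not move z^1. So their integral curves are straight lines in the
    coordinates. *)
Lemma coord_frame_line k x h : coord_frame k (x + h *: coord_frame k x) = coord_frame k x.
Proof.
rewrite /coord_frame !mul_left_mx; move: k; apply: forall_ord6;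
  by congr row6; rewrite !mxE /= ?(mulr0, mulr1, addr0, subr0).
Qed.

Lemma coord_frame_field k : M_field (coord_frame k).
Proof.
rewrite /coord_frame; split.
  by apply: smooth_mulmx; [exact: smooth_cst | exact: smooth_left_mx].
by move=> a x ga; rewrite dleftE left_mx_mul mulmxA.
Qed.

(** The constant is uniform because the second derivative along the frame is
    again invariant, hence bounded by compactness. *)
Lemma Taylor_bound (f : V -> R) k : M_fun f ->
  exists C, forall x h, 0 <= h ->
    h * 'D_(coord_frame k x) f x - C * h ^+ 2 <= f (x + h *: coord_frame k x) - f x.
Proof.
move=> Mf; pose f1 x := 'D_(coord_frame k x) f x; pose f2 x := 'D_(coord_frame k x) f1 x.
have M1 : M_fun f1 := M_fun_derive Mf (coord_frame_field k).
have M2 : M_fun f2 := M_fun_derive M1 (coord_frame_field k).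
have MN : M_fun (fun x => - f2 x).
  by split; [exact: smoothN M2.1 | move=> a x ga; rewrite M2.2].
have [C fC] := invariant_bounded (smooth_cont MN.1) MN.2.
exists (Num.max C 0) => x h h0.
have [c /andP[c0 ch] ->] := MVT_line x (coord_frame k x) Mf.1 h0.
have [e /andP[e0 ec]] := MVT_line x (coord_frame k x) M1.1 c0.
have f1E : f1 (x + c *: coord_frame k x) = 'D_(coord_frame k x) f (x + c *: coord_frame k x).
  by rewrite /f1 coord_frame_line.
have f2E : f2 (x + e *: coord_frame k x) = 'D_(coord_frame k x) f1 (x + e *: coord_frame k x).
  by rewrite /f2 coord_frame_line.
rewrite -f1E -f2E -/(f1 x); have := fC (x + e *: coord_frame k x).
move: (f1 (x + c *: coord_frame k x)) (f2 _) (f1 x) => p q g qC E.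
have q' : - q <= Num.max C 0 by rewrite le_max qC.
have C0 : 0 <= Num.max C 0 by rewrite le_max lexx orbT.
have cq : - (c * q) <= h * Num.max C 0.
  by rewrite -mulrN; apply: le_trans (ler_wpM2l c0 q') _; exact: ler_wpM2r.
have -> : p = g + c * q by lra.
by have := ler_wpM2l h0 cq; lra.
Qed.

Section GridPoints.
Variable N : nat.
Hypothesis N0 : (0 < N)%N.
Let r : R := N%:R^-1.

(** The points of the group of Gaussian points scaled by 1/N in z^1 and z^2
    and by 1/N^2 in z^3. The finer mesh in z^3 makes them a subgroup, since
    z^1 z^2 enters the third coordinate of a product. *)
Definition grid_point (a b c d e h : int) : V :=
  row6 (a%:~R * r) (b%:~R * r) (c%:~R * r) (d%:~R * r)
    (e%:~R * r ^+ 2) (h%:~R * r ^+ 2).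

(** Moving by 1/N along a frame field is right translation by an element of
    the same group, so it acts on the indices. *)
Lemma grid_point_shift a b c d e h :
  [/\ grid_point a b c d e h + r *: coord_frame 0 (grid_point a b c d e h) = grid_point (a + 1) b c d e h,
      grid_point a b c d e h + r *: coord_frame 1 (grid_point a b c d e h) = grid_point a (b + 1) c d e h &
      grid_point a b c d e h + r *: coord_frame 2 (grid_point a b c d e h) = grid_point a b (c + 1) d (e + a) (h + b)] /\
  [/\ grid_point a b c d e h + r *: coord_frame 3 (grid_point a b c d e h) = grid_point a b c (d + 1) (e - b) (h + a),
      grid_point a b c d e h + r *: coord_frame 4 (grid_point a b c d e h) = grid_point a b c d (e + N%:Z) h &
      grid_point a b c d e h + r *: coord_frame 5 (grid_point a b c d e h) = grid_point a b c d e (h + N%:Z)].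
Proof.
have Nr : N%:R * r = 1 :> R by rewrite mulfV// pnatr_eq0 -lt0n.
have rr : r = N%:R * r ^+ 2 by rewrite expr2 mulrA Nr mul1r.
split; split; apply/rowP; apply: forall_ord6; rewrite /coord_frame mul_left_mx !mxE /=.
all: rewrite ?(intrD, intrN, rmorphD, rmorphN, rmorph1) /=; rewrite -?pmulrn; try ring.
all: try (rewrite [X in _ + X * _]rr; ring).
Qed.

(** These are left translations by the six generators of the lattice. The
    first two also shift z^3, by z^2 and by i z^2. *)
Lemma grid_point_invariant (f : V -> R) : (forall a x, gauss a -> f (heis_mul a x) = f x) ->
  forall a b c d e h,
  [/\ f (grid_point (a + N%:Z) b c d (e + N%:Z * c) (h + N%:Z * d)) = f (grid_point a b c d e h),
      f (grid_point a (b + N%:Z) c d (e - N%:Z * d) (h + N%:Z * c)) = f (grid_point a b c d e h) &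
      f (grid_point a b (c + N%:Z) d e h) = f (grid_point a b c d e h)] /\
  [/\ f (grid_point a b c (d + N%:Z) e h) = f (grid_point a b c d e h),
      f (grid_point a b c d (e + (N ^ 2)%N%:Z) h) = f (grid_point a b c d e h) &
      f (grid_point a b c d e (h + (N ^ 2)%N%:Z)) = f (grid_point a b c d e h)].
Proof.
move=> fa a b c d e h; have Nr : N%:R * r = 1 :> R by rewrite mulfV// pnatr_eq0 -lt0n.
have NrZ : N%:Z%:~R * r = 1 :> R by rewrite -pmulrn.
have Nr2 : (N ^ 2)%N%:Z%:~R * r ^+ 2 = 1 :> R by rewrite -pmulrn natrX -exprMn Nr expr1n.
have g6 : forall i j k l m n : int, gauss (row6 i%:~R j%:~R k%:~R l%:~R m%:~R n%:~R : V).
  exact: gauss_row6.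
have E i j k l m n y z : heis_mul (row6 i%:~R j%:~R k%:~R l%:~R m%:~R n%:~R) y = z -> f z = f y.
  by move=> <-; rewrite fa.
split; split; [apply: (E 1 0 0 0 0 0)|apply: (E 0 1 0 0 0 0)|apply: (E 0 0 1 0 0 0)
 |apply: (E 0 0 0 1 0 0)|apply: (E 0 0 0 0 1 0)|apply: (E 0 0 0 0 0 1)];
 rewrite heis_mul_row6 !row6E /grid_point; congr row6;
 rewrite ?(rmorphD, rmorphB, rmorphN, rmorphM) /= ?mulrDl ?NrZ ?Nr2 ?mulNr;
 rewrite ?(expr2 r) ?[N%:Z%:~R * _]mulrC ?mulrA.
all: try ring.
all: have rr : r = N%:Z%:~R * r * r by rewrite NrZ mul1r.
all: have r1 : N%:Z%:~R * r * (N%:Z%:~R * r) = 1 :> R by rewrite NrZ mul1r.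
all: have crr : c%:~R * r = c%:~R * (N%:Z%:~R * r * r) by rewrite -rr.
all: have drr : d%:~R * r = d%:~R * (N%:Z%:~R * r * r) by rewrite -rr.
all: rewrite ?mulr0z ?mulr1z; lra.
Qed.

(** The indices run over representatives of the finite quotient of the group
    of grid points by the lattice. *)
Definition grid_sum (f : V -> R) : R :=
  int_sum N (fun a => int_sum N (fun b => int_sum N (fun c => int_sum N (fun d =>
  int_sum (N ^ 2) (fun e => int_sum (N ^ 2) (fun h => f (grid_point a b c d e h))))))).

Lemma eq_int_sum M (F G : int -> R) : (forall k, F k = G k) -> int_sum M F = int_sum M G.
Proof. by move=> FG; apply: eq_bigr => k _. Qed.

(** Both centre coordinates are shifted at once, because a translation in z^1
    or z^2 moves them together. *)
Lemma int_sum2_shift M (F : int -> int -> R) p q :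
  (forall k l, F (k + M%:Z) l = F k l) -> (forall k l, F k (l + M%:Z) = F k l) ->
  int_sum M (fun k => int_sum M (fun l => F (k + p) (l + q))) =
  int_sum M (fun k => int_sum M (fun l => F k l)).
Proof.
move=> F1 F2.
transitivity (int_sum M (fun k => int_sum M (fun l => F (k + p) l))).
  by apply: eq_int_sum => k; exact: (int_sum_shift q (F2 (k + p))).
apply: (@int_sum_shift _ M (fun k => int_sum M (F k)) p) => k.
by apply: eq_int_sum => l.
Qed.

(** Right translation permutes the finite quotient. Concretely, a translation
    in z^1 or z^2 shifts one outer index and, by amounts that depend on the
    outer indices, the two centre indices; the inner sums absorb the latter by
    periodicity, and the outer sum is then periodic. *)
Lemma grid_sum_shift (f : V -> R) k :
  (forall a x, gauss a -> f (heis_mul a x) = f x) ->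
  grid_sum (fun x => f (x + r *: coord_frame k x)) = grid_sum f.
Proof.
move=> fa; have fI := grid_point_invariant fa.
have sh a b c d p q :
  int_sum (N ^ 2) (fun e => int_sum (N ^ 2) (fun h => f (grid_point a b c d (e + p) (h + q)))) =
  int_sum (N ^ 2) (fun e => int_sum (N ^ 2) (fun h => f (grid_point a b c d e h))).
  by apply: (@int_sum2_shift _ (fun e h => f (grid_point a b c d e h))) => e h;
    have [_ []] := fI a b c d e h.
move: k; apply: forall_ord6; rewrite /grid_sum.
- transitivity (int_sum N (fun a => int_sum N (fun b => int_sum N (fun c => int_sum N (fun d =>
    int_sum (N ^ 2) (fun e => int_sum (N ^ 2) (fun h => f (grid_point (a + 1) b c d e h)))))))).
    apply: eq_int_sum => a; apply: eq_int_sum => b; apply: eq_int_sum => c; apply: eq_int_sum => d; apply: eq_int_sum => e; apply: eq_int_sum => h;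
    by have [[-> _ _] _] := grid_point_shift a b c d e h.
  apply: (@int_sum_shift _ N (fun a => int_sum N (fun b => int_sum N (fun c => int_sum N (fun d =>
    int_sum (N ^ 2) (fun e => int_sum (N ^ 2) (fun h => f (grid_point a b c d e h))))))) 1) => a.
  apply: eq_int_sum => b; apply: eq_int_sum => c; apply: eq_int_sum => d.
  rewrite -(sh _ _ _ _ (N%:Z * c) (N%:Z * d)).
  by apply: eq_int_sum => e; apply: eq_int_sum => h; have [[-> _ _] _] := fI a b c d e h.
- transitivity (int_sum N (fun a => int_sum N (fun b => int_sum N (fun c => int_sum N (fun d =>
    int_sum (N ^ 2) (fun e => int_sum (N ^ 2) (fun h => f (grid_point a (b + 1) c d e h)))))))).
    apply: eq_int_sum => a; apply: eq_int_sum => b; apply: eq_int_sum => c; apply: eq_int_sum => d; apply: eq_int_sum => e; apply: eq_int_sum => h;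
    by have [[_ -> _] _] := grid_point_shift a b c d e h.
  apply: eq_int_sum => a.
  apply: (@int_sum_shift _ N (fun b => int_sum N (fun c => int_sum N (fun d =>
    int_sum (N ^ 2) (fun e => int_sum (N ^ 2) (fun h => f (grid_point a b c d e h)))))) 1) => b.
  apply: eq_int_sum => c; apply: eq_int_sum => d.
  rewrite -(sh _ _ _ _ (- (N%:Z * d)) (N%:Z * c)).
  by apply: eq_int_sum => e; apply: eq_int_sum => h; have [[_ -> _] _] := fI a b c d e h.
- apply: eq_int_sum => a; apply: eq_int_sum => b.
  transitivity (int_sum N (fun c => int_sum N (fun d =>
    int_sum (N ^ 2) (fun e => int_sum (N ^ 2) (fun h => f (grid_point a b (c + 1) d e h)))))).
    apply: eq_int_sum => c; apply: eq_int_sum => d; rewrite -(sh _ _ _ _ a b).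
    apply: eq_int_sum => e; apply: eq_int_sum => h.
    by have [[_ _ ->] _] := grid_point_shift a b c d e h.
  apply: (@int_sum_shift _ N (fun c => int_sum N (fun d =>
    int_sum (N ^ 2) (fun e => int_sum (N ^ 2) (fun h => f (grid_point a b c d e h))))) 1) => c.
  apply: eq_int_sum => d; apply: eq_int_sum => e; apply: eq_int_sum => h.
  by have [[_ _ ->] _] := fI a b c d e h.
- apply: eq_int_sum => a; apply: eq_int_sum => b; apply: eq_int_sum => c.
  transitivity (int_sum N (fun d =>
    int_sum (N ^ 2) (fun e => int_sum (N ^ 2) (fun h => f (grid_point a b c (d + 1) e h))))).
    apply: eq_int_sum => d; rewrite -(sh _ _ _ _ (- b) a).
    apply: eq_int_sum => e; apply: eq_int_sum => h.
    by have [_ [-> _ _]] := grid_point_shift a b c d e h.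
  apply: (@int_sum_shift _ N (fun d =>
    int_sum (N ^ 2) (fun e => int_sum (N ^ 2) (fun h => f (grid_point a b c d e h)))) 1) => d.
  apply: eq_int_sum => e; apply: eq_int_sum => h.
  by have [_ [-> _ _]] := fI a b c d e h.
- apply: eq_int_sum => a; apply: eq_int_sum => b; apply: eq_int_sum => c; apply: eq_int_sum => d.
  rewrite -[RHS](sh _ _ _ _ N%:Z 0).
  apply: eq_int_sum => e; apply: eq_int_sum => h.
  by rewrite addr0; have [_ [_ -> _]] := grid_point_shift a b c d e h.
- apply: eq_int_sum => a; apply: eq_int_sum => b; apply: eq_int_sum => c; apply: eq_int_sum => d.
  rewrite -[RHS](sh _ _ _ _ 0 N%:Z).
  apply: eq_int_sum => e; apply: eq_int_sum => h.
  by rewrite addr0; have [_ [_ _ ->]] := grid_point_shift a b c d e h.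
Qed.

Lemma grid_sum_sub (f g : V -> R) : grid_sum (fun x => f x - g x) = grid_sum f - grid_sum g.
Proof. by rewrite /grid_sum; do 6![rewrite -int_sum_sub; apply: eq_int_sum => ?]. Qed.

Lemma grid_sum_sum (I : Type) (s : seq I) (F : I -> V -> R) :
  grid_sum (fun x => \sum_(i <- s) F i x) = \sum_(i <- s) grid_sum (F i).
Proof. by rewrite /grid_sum; do 6![rewrite -int_sum_sum; apply: eq_int_sum => ?]. Qed.

Lemma grid_sum_gt0 (f : V -> R) : (forall x, 0 < f x) -> 0 < grid_sum f.
Proof.
have N20 : (0 < N ^ 2)%N by rewrite expn_gt0 N0.
by move=> f0; rewrite /grid_sum; do 6![apply: int_sum_gt0 => // ?].
Qed.

End GridPoints.

(** A positive invariant function is bounded below by some m > 0 by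
    compactness, whereas its average over the grid of step 1/N is at most D /
    N, where D bounds the second derivatives: the difference quotients of the
    W k contribute nothing. *)
Lemma no_positive_divergence_coord (W : 'I_6 -> V -> R) : (forall k, M_fun (W k)) ->
  (forall x, 0 < \sum_k 'D_(coord_frame k x) (W k) x) -> False.
Proof.
move=> WM W0; pose w x := \sum_k 'D_(coord_frame k x) (W k) x.
have wM : M_fun w.
  have DM k := M_fun_derive (WM k) (coord_frame_field k).
  split; first by apply: smooth_sum => k; case: (DM k).
  by move=> a x ga; apply: eq_bigr => k _; case: (DM k) => _ ->.
have [m m0 mw] := invariant_pos (smooth_cont wM.1) wM.2 W0.
have /choice [C CP] := fun k => Taylor_bound k (WM k).
pose D := \sum_k `|C k|.
have D0 : 0 <= D by apply: sumr_ge0.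
have [N N0 ND] : exists2 N, (0 < N)%N & D < N%:R * m.
  exists (Num.trunc (D / m)).+1 => //.
  by rewrite -ltr_pdivrMr//; exact: truncnS_gt.
pose r : R := N%:R^-1.
have r0 : 0 < r by rewrite invr_gt0 ltr0n.
have Nr : N%:R * r = 1 by rewrite mulfV// pnatr_eq0 -lt0n.
have pos x : 0 < \sum_k (W k (x + r *: coord_frame k x) - W k x).
  apply: (@lt_le_trans _ _ (r * w x - D * r ^+ 2)); last first.
    rewrite /w /D mulr_sumr mulr_suml -sumrB; apply: ler_sum => k _.
    apply: le_trans (CP k x r (ltW r0)); rewrite lerB// ler_wpM2r//.
    exact: sqr_ge0. exact: ler_norm.
  have h1 : D * r < m by rewrite -[m]mulr1 -Nr mulrA ltr_pM2r// mulrC.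
  rewrite expr2 mulrA [D * r * r]mulrC -mulrBr mulr_gt0// subr_gt0.
  exact: lt_le_trans h1 (mw x).
have := grid_sum_gt0 N0 pos; rewrite grid_sum_sum big1 ?ltxx// => k _.
by rewrite grid_sum_sub grid_sum_shift ?subrr//; case: (WM k).
Qed.

End Divergence.

(** * Connections in a left-invariant frame *)

Section LeftInvariantConnection.
Variable R : realType.
Local Notation V := 'rV[R]_6.
Local Notation e_ := (delta_mx 0 : 'I_6 -> V).
Variables (s t : R) (phi : 'M[R]_6).
Hypothesis iso : lie_iso s t phi.
Local Notation E := (frame phi).
Local Notation cf := (coframe phi).

Lemma M_fun_cst (c : R) : M_fun (fun _ : V => c).
Proof. by split=> //; exact: smooth_cst. Qed.

Lemma M_funD (f h : V -> R) : M_fun f -> M_fun h -> M_fun (fun x => f x + h x).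
Proof.
by move=> [sf fa] [sh ha]; split=> [|a x ga]; [exact: smoothD | rewrite fa// ha].
Qed.

Lemma M_funM (f h : V -> R) : M_fun f -> M_fun h -> M_fun (fun x => f x * h x).
Proof.
by move=> [sf fa] [sh ha]; split=> [|a x ga]; [exact: smoothM | rewrite fa// ha].
Qed.

Lemma M_fun_sum (I : Type) (r : seq I) (f : I -> V -> R) :
  (forall i, M_fun (f i)) -> M_fun (fun x => \sum_(i <- r) f i x).
Proof.
move=> Mf; split=> [|a x ga]; first by apply: smooth_sum => i; case: (Mf i).
by apply: eq_bigr => i _; case: (Mf i) => _ ->.
Qed.

Lemma M_fun_entry (y : V -> V) i : Gamma_invariant y -> M_fun (fun x => y x 0 i).
Proof. by move=> [sy ya]; split; [exact: smooth_entry | move=> a x /ya ->]. Qed.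

Lemma M_fieldD (X Y : V -> V) : M_field X -> M_field Y -> M_field (X \+ Y).
Proof.
move=> [sX Xa] [sY Ya]; split; first exact: smoothD.
by move=> a x ga; rewrite /= Xa// Ya// !dleftE mulmxDl.
Qed.

Lemma M_fieldZ (f : V -> R) (X : V -> V) : M_fun f -> M_field X ->
  M_field (fun x => f x *: X x).
Proof.
move=> [sf fa] [sX Xa]; split; last first.
  by move=> a x ga; rewrite Xa// fa// !dleftE scalemxAl.
apply: smooth_mx => i j; rewrite (_ : (fun x => _) = (fun x => f x * X x i j)).
  by apply: smoothM => //; exact: smooth_entry.
by apply/funext => x; rewrite mxE.
Qed.

Lemma coframe_linear a (X Y : V -> V) x :
  cf (fun x => a *: X x + Y x) x = a *: cf X x + cf Y x.
Proof. by rewrite /coframe !mulmxDl -!scalemxAl. Qed.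

Lemma coframe_frame u x : cf (E u) x = u.
Proof. exact: (frameK iso (fun=> u)). Qed.

Lemma linear_row_sum (W : lmodType R) (f : V -> W) u :
  (forall a v w, f (a *: v + w) = a *: f v + f w) ->
  f u = \sum_k u 0 k *: f (e_ k).
Proof.
move=> fl; pose L := GRing.isLinear.Build _ _ _ _ f fl.
pose LL : {linear V -> W} := HB.pack f L.
rewrite [in LHS](row_sum_delta u) -[f]/(LL : V -> W) linear_sum.
by apply: eq_bigr => k _; rewrite linearZ_LR.
Qed.

Section Connection.
Variable nabla : (V -> V) -> (V -> V) -> (V -> V).
Hypothesis nablaM : M_connection nabla.

(** Row j holds the coefficients of the derivative of the j-th frame field: in
    this frame the covariant derivative is the componentwise derivative plus
    right multiplication by this matrix. *)
Definition conn_mx (X : V -> V) (x : V) : 'M[R]_6 :=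
  \matrix_(j < 6) cf (nabla X (E (e_ j))) x.

Let nabla_sum X (f : 'I_6 -> V -> R) (r : seq 'I_6) : M_field X -> (forall j, M_fun (f j)) ->
  M_field (fun x => \sum_(j <- r) f j x *: E (e_ j) x) /\
  nabla X (fun x => \sum_(j <- r) f j x *: E (e_ j) x) =
  fun x => \sum_(j <- r) ('D_(X x) (f j) x *: E (e_ j) x + f j x *: nabla X (E (e_ j)) x).
Proof.
have [_ _ _ nD nZ] := nablaM.
move=> MX Mf; have ME j : M_field (E (e_ j)) by exact: frame_cst_field.
elim: r => [|i r [IHM IH]].
  have -> : (fun x : V => \sum_(j <- [::]) f j x *: E (e_ j) x) = fun x => 0 *: E (e_ 0) x.
    by apply/funext => x; rewrite big_nil scale0r.
  split; first by apply: M_fieldZ => //; exact: M_fun_cst.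
  rewrite (nZ (fun=> 0))//; last exact: M_fun_cst.
  by apply/funext => x; rewrite big_nil (derive_cst (0 : R)) !scale0r addr0.
have -> : (fun x : V => \sum_(j <- i :: r) f j x *: E (e_ j) x) =
    (fun x => f i x *: E (e_ i) x) \+ (fun x => \sum_(j <- r) f j x *: E (e_ j) x).
  by apply/funext => x; rewrite big_cons.
have Mi : M_field (fun x => f i x *: E (e_ i) x) by exact: M_fieldZ.
split; first exact: M_fieldD.
rewrite nD// IH nZ//.
by apply/funext => x; rewrite big_cons.
Qed.

Lemma coframe_nabla X y x : M_field X -> Gamma_invariant y ->
  cf (nabla X (fun x => E (y x) x)) x = 'D_(X x) y x + y x *m conn_mx X x.
Proof.
move=> MX My; have -> : (fun x => E (y x) x) = fun x => \sum_j y x 0 j *: E (e_ j) x.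
  apply/funext => z; rewrite [in LHS](row_sum_delta (y z)) /frame !mulmx_suml.
  by apply: eq_bigr => j _; rewrite -!scalemxAl.
have [_ ->] := nabla_sum (index_enum 'I_6) MX (fun j => M_fun_entry j My).
rewrite /coframe !mulmx_suml.
under eq_bigr => j _.
  rewrite !mulmxDl -!scalemxAl -/(cf (E (e_ j)) x) coframe_frame.
  rewrite -/(cf (nabla X (E (e_ j))) x).
  over.
rewrite big_split /= mulmx_sum_row; congr (_ + _).
  rewrite [RHS]row_sum_delta; apply: eq_bigr => j _; congr (_ *: _).
  by rewrite (derive_entry _ _ (smooth_derivable x (X x) My.1)).
by apply: eq_bigr => j _; rewrite rowK.
Qed.

Lemma Gamma_invariant_cst u : Gamma_invariant (fun _ : V => u).
Proof. by split=> //; exact: smooth_cst. Qed.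

Lemma coframe_nabla_cst X u x : M_field X -> cf (nabla X (E u)) x = u *m conn_mx X x.
Proof.
move=> MX; rewrite (coframe_nabla x MX (Gamma_invariant_cst u)).
by rewrite (derive_cst u) add0r.
Qed.

Lemma nabla_cst X u x : M_field X -> nabla X (E u) x = E (u *m conn_mx X x) x.
Proof. by move=> MX; rewrite -coframe_nabla_cst// (coframeK iso). Qed.

Lemma conn_mx_linear a u v x :
  conn_mx (E (a *: u + v)) x = a *: conn_mx (E u) x + conn_mx (E v) x.
Proof.
have [_ nD nZ _ _] := nablaM.
have ME w : M_field (E w) by exact: frame_cst_field.
have MZ : M_field (fun x => a *: E u x).
  by apply: (M_fieldZ (f := fun=> a)) => //; exact: M_fun_cst.
apply/row_matrixP => j; rewrite linearP /= !rowK.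
have -> : E (a *: u + v) = (fun x => a *: E u x) \+ E v.
  by apply/funext => y; exact: frame_linear.
rewrite nD// (nZ (fun=> a))//; last exact: M_fun_cst.
exact: coframe_linear.
Qed.

Lemma conn_mx_field X j : M_field X -> Gamma_invariant (fun x => row j (conn_mx X x)).
Proof.
have [nM _ _ _ _] := nablaM.
move=> MX; rewrite (_ : (fun x => _) = cf (nabla X (E (e_ j)))).
  by apply: coframe_inv; apply: nM => //; exact: frame_cst_field.
by apply/funext => x; rewrite rowK.
Qed.

Lemma conn_mx_entry X i j : M_field X -> M_fun (fun x => conn_mx X x i j).
Proof.
move=> MX; have [sy ya] := M_fun_entry j (conn_mx_field i MX).
split.
  rewrite (_ : (fun x => _) = (fun x => row i (conn_mx X x) 0 j))//.
  by apply/funext => x; rewrite [RHS]mxE.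
by move=> a x ga; have := ya a x ga; rewrite [LHS]mxE [RHS]mxE.
Qed.

Lemma smooth_conn_mx X : M_field X -> smooth (conn_mx X).
Proof. by move=> MX; apply: smooth_mx => i j; case: (conn_mx_entry i j MX). Qed.

(** The order of the products is opposite to the usual one because the
    connection matrices act from the right. *)
Lemma coframe_curvature u v w x :
  cf (curvature nabla (E u) (E v) (E w)) x =
  w *m ('D_(E u x) (conn_mx (E v)) x - 'D_(E v x) (conn_mx (E u)) x
        + conn_mx (E v) x *m conn_mx (E u) x - conn_mx (E u) x *m conn_mx (E v) x
        - conn_mx (E (gst_br s t u v)) x).
Proof.
have ME z : M_field (E z) by exact: frame_cst_field.
have [nM _ _ _ _] := nablaM.
have two a b : cf (nabla (E a) (nabla (E b) (E w))) x =
    w *m 'D_(E a x) (conn_mx (E b)) x + w *m conn_mx (E b) x *m conn_mx (E a) x.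
  have My : Gamma_invariant (fun x => w *m conn_mx (E b) x).
    rewrite (_ : (fun x => _) = cf (nabla (E b) (E w))).
      by apply: coframe_inv; exact: nM.
    by apply/funext => z; rewrite coframe_nabla_cst.
  have -> : nabla (E b) (E w) = fun x => E (w *m conn_mx (E b) x) x.
    by apply/funext => z; rewrite nabla_cst.
  rewrite coframe_nabla//; congr (_ + _).
  rewrite derive_mulmx; [|exact: smooth_cst|exact: smooth_conn_mx].
  by rewrite (derive_cst w) mul0mx add0r.
have -> : cf (curvature nabla (E u) (E v) (E w)) x =
    cf (nabla (E u) (nabla (E v) (E w))) x - cf (nabla (E v) (nabla (E u) (E w))) x
    - cf (nabla (field_br (E u) (E v)) (E w)) x.
  by rewrite /coframe /curvature !mulmxBl.
rewrite !two (field_br_cst iso) coframe_nabla_cst// !(mulmxBr, mulmxDr) !mulmxA.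
by rewrite opprD addrACA !addrA.
Qed.

Lemma coframe_torsion u v x :
  cf (torsion nabla (E u) (E v)) x =
  v *m conn_mx (E u) x - u *m conn_mx (E v) x - gst_br s t u v.
Proof.
have ME z : M_field (E z) by exact: frame_cst_field.
have -> : cf (torsion nabla (E u) (E v)) x =
    cf (nabla (E u) (E v)) x - cf (nabla (E v) (E u)) x
    - cf (field_br (E u) (E v)) x.
  by rewrite /coframe /torsion !mulmxBl.
by rewrite (field_br_cst iso) coframe_frame !coframe_nabla_cst.
Qed.

End Connection.
End LeftInvariantConnection.

(** * Pointwise algebra of a Hermitian connection with skew torsion *)

Section BismutAlgebra.
Variables (K : numFieldType) (n : nat).
Variables (A : 'I_n -> 'M[K]_n) (G H J : 'M[K]_n) (c : 'I_n -> 'I_n -> 'rV[K]_n).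
Hypotheses (GH : G *m H = 1%:M) (Gtr : G^T = G) (Jtr : J^T = - J).
Hypotheses (JG : J *m G = G *m J) (JA : forall j, J *m A j = A j *m J).
Hypothesis c_tr : forall a, \sum_j c j a 0 j = 0.
Hypothesis c_trJ : forall i, \sum_j \sum_l J j l * c i l 0 j = 0.

Let t i j := row j (A i) - row i (A j) - c i j.
Hypothesis t_skew : forall a i j, (t i j *m G) 0 a = - (t a j *m G) 0 i.

Let d a := \tr (A a).
Let b i := \tr (A i *m J).
Let B := H *m J.
Let T a i j := (t i j *m G) 0 a.

Let HG : H *m G = 1%:M. Proof. exact: mulmx1C. Qed.

Lemma inv_sym_tr : H^T = H.
Proof.
have HtG : H^T *m G = 1%:M by rewrite -{1}Gtr -trmx_mul GH trmx1.
by rewrite -[LHS]mulmx1 -GH mulmxA HtG mul1mx.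
Qed.

Lemma inv_comm : J *m H = H *m J.
Proof. by rewrite -[LHS]mul1mx -HG -mulmxA (mulmxA G) -JG -(mulmxA J) GH mulmx1. Qed.

Lemma bivector_anti i j : B i j = - B j i.
Proof.
have : B^T = - B by rewrite /B trmx_mul inv_sym_tr Jtr mulNmx inv_comm.
by move=> /(congr1 (fun M : 'M[K]_n => M j i)); rewrite !mxE.
Qed.

Let TT a i j : T a i j = - T i a j. Proof. exact: t_skew. Qed.
Let tT i j k : t i j 0 k = \sum_a T a i j * H a k.
Proof. by rewrite -[t i j]mulmx1 -GH mulmxA mxE. Qed.

Let A_flip i j k : A i j k = A j i k + c i j 0 k + t i j 0 k.
Proof. by rewrite /t !mxE; ring. Qed.

Lemma sum_anti0 (F : 'I_n -> 'I_n -> K) : (forall i j, F i j = - F j i) ->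
  \sum_i \sum_j F i j = 0.
Proof.
move=> Fa; have E : \sum_i \sum_j F i j = - \sum_i \sum_j F i j.
  rewrite [LHS]exchange_big /= -sumrN; apply: eq_bigr => i _.
  by rewrite -sumrN; apply: eq_bigr => j _.
have : (\sum_i \sum_j F i j) *+ 2 = 0 by rewrite mulr2n {1}E addNr.
by move/eqP; rewrite mulrn_eq0 => /eqP.
Qed.

(** The divergence of a frame field with respect to the connection. Torsion
    does not contribute to it by skewness, and neither do the structure
    constants, by unimodularity. *)
Lemma connection_div a : \sum_j A j a j = d a.
Proof.
under eq_bigr => j _ do rewrite A_flip.
rewrite !big_split /= c_tr addr0 -[RHS]addr0; congr (_ + _).
under eq_bigr => j _ do rewrite tT.
apply: sum_anti0 => j k; rewrite TT mulNr.
by congr (- (_ * _)); rewrite -[in RHS]inv_sym_tr mxE.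
Qed.

Let Bt k := \sum_j \sum_l B j l * t j l 0 k.
Let Bc k := \sum_j \sum_l B j l * c j l 0 k.

(** B is antisymmetric, so only the antisymmetric part of the connection is
    seen: torsion and structure constants. *)
Lemma bivector_connection k :
  \sum_j (H *m A j *m J) j k = 2^-1 * (Bc k + Bt k).
Proof.
have -> : \sum_j (H *m A j *m J) j k = \sum_j \sum_l B j l * A j l k.
  by apply: eq_bigr => j _; rewrite -mulmxA -JA mulmxA mxE.
set S := LHS.
have SN : \sum_j \sum_l B j l * A l j k = - S.
  rewrite exchange_big /= /S -sumrN; apply: eq_bigr => l _.
  by rewrite -sumrN; apply: eq_bigr => j _; rewrite (bivector_anti j l) mulNr.
have E : S = - S + (Bc k + Bt k).
  rewrite -SN /Bc /Bt -!big_split /=; apply: eq_bigr => j _.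
  by rewrite -!big_split /=; apply: eq_bigr => l _; rewrite A_flip; ring.
have E2 : S + S = Bc k + Bt k by rewrite {1}E addrAC addNr add0r.
by rewrite -E2 -mulr2n -[S *+ 2]mulr_natl mulKf// pnatr_eq0.
Qed.

(** The index i is moved from the differentiating to the differentiated slot,
    at the cost of torsion and structure constants; then J is moved across A l
    and what is left is a divergence. The torsion term is the Lee form. *)
Lemma ricci_potentialE i :
  b i = - \sum_a d a * J a i - \sum_k Bt k * G k i.
Proof.
have -> : b i = \sum_j \sum_l J j l * A i l j.
  by rewrite /b -JA; apply: eq_bigr => j _; rewrite mxE.
have -> : \sum_j \sum_l J j l * A i l j = \sum_j \sum_l J j l * A l i j
    + \sum_j \sum_l J j l * c i l 0 j + \sum_j \sum_l J j l * t i l 0 j.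
  rewrite -!big_split /=; apply: eq_bigr => j _.
  by rewrite -!big_split /=; apply: eq_bigr => l _; rewrite A_flip; ring.
rewrite c_trJ addr0; congr (_ + _).
  rewrite exchange_big /=.
  have -> : \sum_l \sum_j J j l * A l i j = \sum_l \sum_a J i a * A l a l.
    apply: eq_bigr => l _; transitivity ((A l *m J) i l).
      by rewrite mxE; apply: eq_bigr => j _; rewrite mulrC.
    by rewrite -JA mxE.
  rewrite exchange_big /= -sumrN; apply: eq_bigr => a _.
  rewrite -mulr_sumr connection_div mulrC -mulrN; congr (_ * _).
  by move/(congr1 (fun M : 'M[K]_n => M a i)): Jtr; rewrite !mxE.
have -> : \sum_k Bt k * G k i = \sum_j \sum_l B j l * T i j l.
  rewrite /Bt; under eq_bigr => k _ do rewrite mulr_suml.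
  rewrite exchange_big /=; apply: eq_bigr => j _.
  under eq_bigr => k _ do rewrite mulr_suml.
  rewrite exchange_big /=; apply: eq_bigr => l _.
  have -> : T i j l = \sum_k t j l 0 k * G k i by rewrite /T mxE.
  by rewrite mulr_sumr; apply: eq_bigr => k _; rewrite mulrA.
rewrite -sumrN.
have E l j : \sum_a J j l * (T a i l * H a j) = J j l * t i l 0 j.
  by rewrite tT mulr_sumr.
under eq_bigr => j _ do under eq_bigr => l _ do rewrite -E.
rewrite exchange_big /=.
under eq_bigr => l _ do rewrite exchange_big /=.
rewrite exchange_big /=; apply: eq_bigr => a _; rewrite -sumrN; apply: eq_bigr => l _.
have -> : T a i l = - T i a l by rewrite TT.
have -> : B a l = \sum_j H a j * J j l by rewrite /B mxE.
by rewrite mulr_suml -sumrN; apply: eq_bigr => j _; ring.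
Qed.

(** The first term is the derivative of H J, computed from the compatibility
    of the connection with the metric. The second one is the logarithmic
    derivative of the weight (det G)^(1/4). The exponent 1/4 is the one for
    which the terms with [d] combine with the torsion to a multiple of [b]. *)
Lemma bismut_divergence k :
  \sum_j (- (H *m (A j *m G + G *m (A j)^T) *m H *m J)) j k
  + 2^-1 * \sum_a d a * B a k
  + 2^-1 * \sum_j \sum_l B j l * c j l 0 k
  = 2^-1 * \sum_i b i * H i k.
Proof.
have -> : \sum_j (- (H *m (A j *m G + G *m (A j)^T) *m H *m J)) j k =
    - (2^-1 * (Bc k + Bt k)) - \sum_a d a * B a k.
  have -> : \sum_a d a * B a k = \sum_j ((A j)^T *m B) j k.
    under eq_bigr => a _ do rewrite -connection_div mulr_suml.
    rewrite exchange_big /=; apply: eq_bigr => j _; rewrite [RHS]mxE.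
    by apply: eq_bigr => a _; congr (_ * _); rewrite mxE.
  rewrite -bivector_connection -opprD -big_split /= -sumrN; apply: eq_bigr => j _.
  have -> : H *m (A j *m G + G *m (A j)^T) *m H *m J
      = H *m A j *m J + (A j)^T *m B.
    rewrite mulmxDr !mulmxDl; congr (_ + _).
      by rewrite (mulmxA H) -(mulmxA (H *m A j)) GH mulmx1.
    by rewrite (mulmxA H) HG mul1mx -mulmxA.
  by rewrite mxE [in LHS]mxE.
have -> : \sum_i b i * H i k = - \sum_a d a * B a k - Bt k.
  have [bt btE] : exists bt, bt =1 Bt by exists Bt.
  have rp i : b i = - \sum_a d a * J a i - \sum_k bt k * G k i.
    by rewrite ricci_potentialE; congr (_ - _); apply: eq_bigr => l _; rewrite btE.
  rewrite -btE; under eq_bigr => i _ do rewrite rp mulrBl mulNr !mulr_suml.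
  rewrite big_split /= !sumrN; congr (- _ - _).
    rewrite exchange_big /=; apply: eq_bigr => a _.
    under eq_bigr => i _ do rewrite -mulrA.
    by rewrite -mulr_sumr; congr (_ * _); rewrite /B -inv_comm mxE.
  have sumGH l : \sum_i bt l * G l i * H i k = bt l * (l == k)%:R.
    under eq_bigr => i _ do rewrite -mulrA.
    by rewrite -mulr_sumr; move/matrixP/(_ l k): GH; rewrite !mxE => ->.
  rewrite exchange_big /=; under eq_bigr => l _ do rewrite sumGH.
  rewrite (bigD1 k)//= eqxx mulr1 [X in _ + X]big1 ?addr0// => l lk.
  by rewrite (negbTE lk) mulr0.
by rewrite -/(Bc k); field.
Qed.

(** The logarithmic derivative of det G, by compatibility of the connection
    with the metric. *)
Lemma metric_trace a : \tr (H *m (A a *m G + G *m (A a)^T)) = d a *+ 2.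
Proof.
rewrite mulmxDr linearD /= !mulmxA HG mul1mx mxtrace_tr -mulmxA mxtrace_mulC.
by rewrite -mulmxA GH mulmx1 mulr2n.
Qed.
End BismutAlgebra.

(** * Structure constants *)

Section StructureConstants.
Variables (R : realType) (s t : R).
Local Notation V := 'rV[R]_6.
Local Notation e_ := (delta_mx 0 : 'I_6 -> V).
Local Notation J := (@Jmx R).
Let c i j := gst_br s t (e_ i) (e_ j).

Lemma gst_br_anti (u v : V) : gst_br s t u v = - gst_br s t v u.
Proof.
by apply/rowP; apply: forall_ord6; rewrite !mxE /= ?/de5 ?/de6 /wedge; ring.
Qed.

Lemma sum6 (F : 'I_6 -> R) : \sum_i F i = F 0 + F 1 + F 2 + F 3 + F 4 + F 5.
Proof.
rewrite !big_ord_recl big_ord0 addr0 !addrA.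
by do ?congr (_ + _); congr F; apply: val_inj.
Qed.

(** Unimodularity: the bracket is central. *)
Lemma gst_ad_trace a : \sum_j c j a 0 j = 0.
Proof.
rewrite sum6 /c !gst_br_row6 !row6E /de5 /de6 /wedge.
move: a; apply: forall_ord6; rewrite !mxE /=; ring.
Qed.

(** Brackets are central, and the centre is J-invariant. *)
Lemma gst_adJ_trace i : \sum_j \sum_l J j l * c i l 0 j = 0.
Proof.
suff T j l : J j l * c i l 0 j = 0 by rewrite big1// => j _; rewrite big1.
move: j l; apply: forall_ord6; apply: forall_ord6;
  rewrite /c gst_br_row6 row6E /de5 /de6 /wedge !mxE /=; ring.
Qed.

Lemma delta_contract (M : 'M[R]_6) k l :
  \sum_i \sum_j M i j * ((e_ i) 0 k * (e_ j) 0 l) = M k l.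
Proof.
rewrite (bigD1 k)//= [X in _ + X]big1 => [|i ik]; last first.
  by apply: big1 => j _; rewrite [(e_ i) 0 k]mxE [k == i]eq_sym (negbTE ik) andbF mul0r mulr0.
rewrite addr0 (bigD1 l)//= [X in _ + X]big1 => [|j jl]; last first.
  by rewrite [(e_ j) 0 l]mxE [l == j]eq_sym (negbTE jl) andbF !mulr0.
by rewrite addr0 !mxE !eqxx !mulr1.
Qed.

(** H J is of type (1,1), so its components along e_1 /\ e_3 and e_2 /\ e_4
    agree, and the t-terms of d e^5 cancel. *)
Lemma contract_de5 (H : 'M[R]_6) : H^T = H -> J *m H = H *m J ->
  \sum_j \sum_l (H *m J) j l * c j l 0 4 =
  - (2 * (s * (H 0 0 + 2 * H 2 2))).
Proof.
move=> Hs JH; pose B := H *m J.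
have Bent i : [/\ B i 0 = - H i 1, B i 1 = H i 0, B i 2 = - H i 3 & B i 3 = H i 2].
  by split; rewrite /B mxE sum6 !mxE /=; ring.
have JHent : [/\ (J *m H) 0 1 = H 1 1, (J *m H) 0 2 = H 1 2 & (J *m H) 2 3 = H 3 3].
  by split; rewrite mxE sum6 !mxE /=; ring.
have Hsym i k : H i k = H k i by rewrite -[in LHS]Hs mxE.
have H11 : H 1 1 = H 0 0 by case: JHent => <- _ _; rewrite JH; case: (Bent 0).
have H33 : H 3 3 = H 2 2 by case: JHent => _ _ <-; rewrite JH; case: (Bent 2).
have H12 : H 1 2 = - H 0 3 by case: JHent => _ <- _; rewrite JH; case: (Bent 0).
have cE j l : c j l 0 4 = - de5 s t (e_ j) (e_ l) by rewrite /c gst_br_row6 row6E.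
have wE (k l : 'I_6) : \sum_i \sum_j B i j * wedge k l (e_ i) (e_ j) = B k l - B l k.
  by rewrite /wedge -(delta_contract B k l) -(delta_contract B l k) -sumrB;
    apply: eq_bigr => i _; rewrite -sumrB; apply: eq_bigr => j _; rewrite mulrBr.
transitivity (- (s * (B 0 1 - B 1 0) + 2 * s * (B 2 3 - B 3 2)
   + t * (B 0 2 - B 2 0) - t * (B 1 3 - B 3 1))).
  rewrite -!wE !mulr_sumr -!big_split /= -sumrB -sumrN; apply: eq_bigr => i _.
  rewrite !mulr_sumr -!big_split /= -sumrB -sumrN; apply: eq_bigr => j _.
  by rewrite cE /de5 -/B; ring.
have [B00 B01 B02 B03] := Bent 0; have [B10 B11 B12 B13] := Bent 1.
have [B20 B21 B22 B23] := Bent 2; have [B30 B31 B32 B33] := Bent 3.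
rewrite B01 B10 B23 B32 B02 B20 B13 B31 H11 H33 H12 (Hsym 2 1) H12 (Hsym 3 0); ring.
Qed.

End StructureConstants.

(** * Hermitian metrics in a left-invariant frame *)

Section Forward.
Variable R : realType.
Local Notation V := 'rV[R]_6.
Local Notation e_ := (delta_mx 0 : 'I_6 -> V).
Local Notation J := (@Jmx R).
Variables (s t : R) (phi : 'M[R]_6).
Hypothesis iso : lie_iso s t phi.
Local Notation E := (frame phi).
Local Notation cf := (coframe phi).

(** Both frames span the same left-invariant fields, so the divergence is that
    of a constant linear combination of the functions W k. *)
Lemma no_positive_divergence (W : 'I_6 -> V -> R) : (forall k, M_fun (W k)) ->
  (forall x, 0 < \sum_k 'D_(E (e_ k) x) (W k) x) -> False.
Proof.
move=> WM W0; pose U k x := \sum_j phi j k * W j x.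
apply: (@no_positive_divergence_coord _ U) => [k|x].
  split=> [|a x ga]; last by apply: eq_bigr => j _; case: (WM j) => _ ->.
  apply: smooth_sum => j; apply: smoothM; first exact: smooth_cst.
  by case: (WM j).
have -> : \sum_k 'D_(coord_frame k x) (U k) x = \sum_k 'D_(E (e_ k) x) (W k) x; last exact: W0.
have EE j : E (e_ j) x = \sum_k phi j k *: coord_frame k x.
  rewrite /frame -rowE [row j phi]row_sum_delta mulmx_suml.
  by apply: eq_bigr => k _; rewrite mxE -scalemxAl.
under [RHS]eq_bigr => j _.
  rewrite EE deriveE; last by apply: smooth_diff; case: (WM j).
  rewrite linear_sum /=.
  over.
rewrite exchange_big /=; apply: eq_bigr => k _.
rewrite derive_sum_fun => [|j]; last first.
  by apply: smoothM; [exact: smooth_cst | case: (WM j)].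
apply: eq_bigr => j _.
rewrite derive_mul; [|exact: smooth_cst|by case: (WM j)].
rewrite (derive_cst (phi j k)) mul0r add0r linearZ_LR -deriveE//.
by apply: smooth_diff; case: (WM j).
Qed.

Variable g : V -> 'M[R]_6.
Hypothesis Hg : hermitian_metric (Jphi phi) g.

Definition gram (x : V) : 'M[R]_6 :=
  phi *m left_mx x *m g x *m (phi *m left_mx x)^T.

Lemma gval_gram u v x : gval g x (E u x) (E v x) = (u *m gram x *m v^T) 0 0.
Proof. by rewrite /gval /frame /gram !trmx_mul !mulmxA. Qed.

Lemma bilin_delta (M : 'M[R]_6) a b : (e_ a *m M *m (e_ b)^T) 0 0 = M a b.
Proof. by rewrite -rowE trmx_delta -colE !mxE. Qed.

Lemma gram_entry x i j : gram x i j = gval g x (E (e_ i) x) (E (e_ j) x).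
Proof. by rewrite gval_gram bilin_delta. Qed.

Lemma gram_sym x : (gram x)^T = gram x.
Proof.
have [[_ _ gs _] _] := Hg.
apply/matrixP => i j; rewrite [LHS]mxE (gram_entry x j i) (gram_entry x i j).
exact: gs.
Qed.

Lemma gram_pos x (u : V) : u != 0 -> 0 < (u *m gram x *m u^T) 0 0.
Proof.
have [[_ _ _ grid_point] _] := Hg.
move=> u0; rewrite -gval_gram; apply: grid_point; apply: contra_neq u0 => E0.
by have := coframe_frame iso u x; rewrite /coframe E0 !mul0mx.
Qed.

Lemma smooth_gram : smooth gram.
Proof.
have [[sg _ _ _] _] := Hg.
have sP : smooth (fun x : V => phi *m left_mx x).
  by apply: smooth_mulmx; [exact: smooth_cst | exact: smooth_left_mx].
apply: smooth_mulmx; first exact: smooth_mulmx.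
apply: smooth_mx => i j.
rewrite (_ : (fun x => _) = (fun x => (phi *m left_mx x) j i)).
  exact: (smooth_entry j i sP).
by apply/funext => x; rewrite mxE.
Qed.

Lemma gram_invariant a x : gauss a -> gram (heis_mul a x) = gram x.
Proof.
have [[_ ga _ _] _] := Hg.
move=> gsa; apply/matrixP => i j; rewrite !gram_entry.
have Ea u : E u (heis_mul a x) = dleft a x (E u x).
  by have [_ ->] := frame_cst_field phi u.
by rewrite !Ea ga.
Qed.

(** The metric is Hermitian and J is orthogonal for the standard scalar
    product, hence they commute. *)
Lemma gram_J x : J *m gram x = gram x *m J.
Proof.
have [_ gJ] := Hg.
have JGJ : J *m gram x *m J^T = gram x.
  apply/matrixP => i j.
  transitivity (gval g x (E (e_ i *m J) x) (E (e_ j *m J) x)).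
    by rewrite gval_gram trmx_mul -[LHS]bilin_delta !mulmxA.
  by rewrite -!(Jphi_frame iso) gJ gval_gram bilin_delta.
by rewrite -{2}JGJ Jmx_tr -mulmxA mulNmx Jmx_sqr opprK mulmx1.
Qed.

Lemma gram_orthonormal x : exists O : 'M[R]_6, O *m gram x *m O^T = 1%:M.
Proof. by apply: orthonormal_basis; [exact: gram_sym | exact: gram_pos]. Qed.

Lemma gram_det_gt0 x : 0 < \det (gram x).
Proof.
have [Q QGQ] := gram_orthonormal x; have := congr1 (@determinant R 6) QGQ.
rewrite (det_mulmx (Q *m gram x)) (det_mulmx Q) det_tr det1 mulrAC -expr2 => D1.
rewrite -(pmulr_rgt0 _ (x := \det Q ^+ 2)) ?D1 ?ltr01//.
rewrite lt_neqAle sqr_ge0 andbT eq_sym; apply/eqP => O0.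
by move/eqP: D1; rewrite O0 mul0r eq_sym oner_eq0.
Qed.

Lemma gram_unit x : gram x \in unitmx.
Proof. by rewrite unitmxE unitfE gt_eqF// gram_det_gt0. Qed.

Definition cogram x := invmx (gram x).

Lemma gramK x : gram x *m cogram x = 1%:M.
Proof. exact: mulmxV (gram_unit x). Qed.

Lemma smooth_cogram : smooth cogram.
Proof. by apply: smooth_invmx; [exact: smooth_gram | exact: gram_unit]. Qed.

Lemma cogram_sym x : (cogram x)^T = cogram x.
Proof. exact: inv_sym_tr (gramK x) (gram_sym x). Qed.

Lemma cogram_J x : J *m cogram x = cogram x *m J.
Proof. exact: inv_comm (gramK x) (gram_J x). Qed.

Lemma cogram_pos x (u : V) : u != 0 -> 0 < (u *m cogram x *m u^T) 0 0.
Proof.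
move=> u0; have HG := mulmx1C (gramK x).
have -> : u *m cogram x *m u^T = (u *m cogram x) *m gram x *m (u *m cogram x)^T.
  rewrite trmx_mul cogram_sym -(mulmxA _ (cogram x) (gram x)) HG mulmx1.
  by rewrite mulmxA.
apply: gram_pos; apply: contra_neq u0 => uH0.
by rewrite -[u]mulmx1 -HG mulmxA uH0 mul0mx.
Qed.

Lemma cogram_ge0 x (u : V) : 0 <= (u *m cogram x *m u^T) 0 0.
Proof.
have [->|u0] := eqVneq u 0; first by rewrite !mul0mx mxE.
exact: ltW (cogram_pos x u0).
Qed.

End Forward.

(** * A flat Bismut Ricci form forces s = 0 *)

Section RicciFlat.
Variable R : realType.
Local Notation V := 'rV[R]_6.
Local Notation e_ := (delta_mx 0 : 'I_6 -> V).
Local Notation J := (@Jmx R).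
Variables (s t : R) (phi : 'M[R]_6).
Hypothesis iso : lie_iso s t phi.
Local Notation E := (frame phi).
Local Notation cf := (coframe phi).
Variable g : V -> 'M[R]_6.
Hypothesis Hg : hermitian_metric (Jphi phi) g.
Variable nabla : (V -> V) -> (V -> V) -> (V -> V).
Hypothesis Hn : bismut_connection (Jphi phi) g nabla.

Local Notation G := (gram phi g).
Local Notation H := (cogram phi g).
Local Notation A := (fun i => conn_mx phi nabla (E (e_ i))).
Local Notation c := (fun i j => gst_br s t (e_ i) (e_ j)).

Let nablaM : M_connection nabla. Proof. by case: Hn. Qed.
Let ME u : M_field (E u). Proof. exact: frame_cst_field. Qed.

Lemma derive_gram u x : 'D_(E u x) G x =
  conn_mx phi nabla (E u) x *m G x + G x *m (conn_mx phi nabla (E u) x)^T.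
Proof.
have [_ met _ _] := Hn.
have sG := smooth_gram Hg.
apply/matrixP => i j; rewrite (derive_entry _ _ (smooth_derivable x (E u x) sG)).
rewrite (_ : (fun x => _) = (fun y => gval g y (E (e_ i) y) (E (e_ j) y))); last first.
  by apply/funext => y; rewrite gram_entry.
rewrite met//; rewrite !(nabla_cst iso nablaM)// !gval_gram.
rewrite -[RHS]bilin_delta mulmxDr mulmxDl [in RHS]mxE.
by rewrite trmx_mul !mulmxA.
Qed.

Lemma conn_mx_J u x : J *m conn_mx phi nabla (E u) x = conn_mx phi nabla (E u) x *m J.
Proof.
have [_ _ nJ _] := Hn.
apply/row_matrixP => i; rewrite !rowE !mulmxA.
have := nJ (E u) (E (e_ i)) (ME _) (ME _) x.
have -> : (fun y => Jphi phi y (E (e_ i) y)) = E (e_ i *m J).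
  by apply/funext => y; rewrite (Jphi_frame iso).
rewrite !(nabla_cst iso nablaM)// (Jphi_frame iso) => eqE.
have := congr1 (fun w => w *m left_mx (heis_inv x) *m invmx phi) eqE.
have fc w : E w x *m left_mx (heis_inv x) *m invmx phi = w by exact: (coframe_frame iso w x).
by rewrite !fc.
Qed.

Lemma torsion_skew x a i j :
  ((row j (A i x) - row i (A j x) - c i j) *m G x) 0 a =
  - ((row j (A a x) - row a (A j x) - c a j) *m G x) 0 i.
Proof.
have [_ _ _ tor] := Hn.
have tE k l : torsion nabla (E (e_ k)) (E (e_ l)) x =
    E (row l (A k x) - row k (A l x) - c k l) x.
  by rewrite !rowE -(coframe_torsion iso nablaM) (coframeK iso).
have := tor (E (e_ a)) (E (e_ i)) (E (e_ j)) (ME _) (ME _) (ME _) x.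
rewrite !tE !gval_gram.
have sw k (w : V) : (e_ k *m G x *m w^T) 0 0 = (w *m G x) 0 k.
  transitivity ((e_ k *m G x *m w^T)^T 0 0); first by rewrite [RHS]mxE.
  rewrite trmx_mul trmxK trmx_mul (gram_sym Hg) mulmxA.
  by rewrite trmx_delta -colE mxE.
by rewrite !sw.
Qed.

(** The components of a 1-form whose differential is a multiple of the Ricci
    form. *)
Definition ricci_potential i x : R := \tr (A i x *m J).

Lemma ricci_potential_fun i : M_fun (ricci_potential i).
Proof.
have MA k l := conn_mx_entry phi nablaM k l (ME (e_ i)).
split=> [|a x ga].
  rewrite /ricci_potential /mxtrace; apply: smooth_sum => k.
  rewrite (_ : (fun x => _) = (fun x => \sum_l A i x k l * J l k)).
    apply: smooth_sum => l; apply: smoothM; last exact: smooth_cst.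
    by case: (MA k l).
  by apply/funext => x; rewrite mxE.
have AE : A i (heis_mul a x) = A i x.
  by apply/matrixP => k l; have [_ Akl] := MA k l; exact: (Akl a x ga).
by rewrite /ricci_potential AE.
Qed.

Lemma derive_ricci_potential i u x :
  'D_(E u x) (ricci_potential i) x = \tr ('D_(E u x) (A i) x *m J).
Proof.
have sA : smooth (A i) by exact: smooth_conn_mx.
rewrite /ricci_potential /mxtrace derive_sum_fun => [|k]; last first.
  apply: (smooth_entry k k (smooth_mulmx sA (smooth_cst J))).
apply: eq_bigr => k _.
have sAJ := smooth_mulmx sA (smooth_cst J).
rewrite -(derive_entry _ _ (smooth_derivable x (E u x) sAJ)) derive_mulmx//; last exact: smooth_cst.
by rewrite (derive_cst J) mulmx0 addr0.
Qed.

Hypothesis flat : ricci_flat (Jphi phi) g nabla.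

(** Commuting with J kills the trace of J against [A i, A j], and the
    curvature leaves only the differential of the 1-form. The hypothesis
    concerns orthonormal frames, so it is applied to a constant combination of
    the frame fields that is orthonormal at x. *)
Lemma ricci_potential_closed i j x :
  'D_(E (e_ i) x) (ricci_potential j) x - 'D_(E (e_ j) x) (ricci_potential i) x
  = \sum_k c i j 0 k * ricci_potential k x.
Proof.
have [Q QGQ] := gram_orthonormal iso Hg x.
pose K := 'D_(E (e_ i) x) (A j) x - 'D_(E (e_ j) x) (A i) x
        + A j x *m A i x - A i x *m A j x
        - conn_mx phi nabla (E (c i j)) x.
have curvE w : curvature nabla (E (e_ i)) (E (e_ j)) (E w) x = E (w *m K) x.
  by rewrite -(coframe_curvature iso nablaM) (coframeK iso).
have on k l : gval g x (E (row k Q) x) (E (row l Q) x) = (k == l)%:R.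
  rewrite gval_gram rowE (rowE l) trmx_mul.
  transitivity ((e_ k *m (Q *m G x *m Q^T) *m (e_ l)^T) 0 0).
    by rewrite !mulmxA.
  by rewrite QGQ bilin_delta mxE.
have := flat (e := fun k => E (row k Q)) (fun k => ME _) on (ME (e_ i)) (ME (e_ j)).
rewrite /ricci_form => /eqP; rewrite mulf_eq0 invr_eq0 pnatr_eq0 /= => /eqP.
have -> : \sum_k gval g x (curvature nabla (E (e_ i)) (E (e_ j)) (E (row k Q)) x)
    (Jphi phi x (E (row k Q) x)) = \tr (Q *m (K *m G x *m J^T) *m Q^T).
  apply: eq_bigr => k _; rewrite curvE (Jphi_frame iso) gval_gram.
  rewrite !rowE trmx_mul trmx_mul -[RHS]bilin_delta.
  by rewrite !mulmxA.
have QtQ : Q^T *m Q = H x.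
  have Qu : Q *m (G x *m Q^T) = 1%:M by rewrite mulmxA.
  have Q1 := mulmx1C Qu.
  have GH := gramK iso Hg x.
  have HG := mulmx1C GH.
  transitivity (H x *m (G x *m (Q^T *m Q))); first by rewrite (mulmxA (H x)) HG mul1mx.
  by rewrite (mulmxA (G x)) Q1 mulmx1.
rewrite mxtrace_mulC mulmxA QtQ mxtrace_mulC.
have -> : K *m G x *m J^T *m H x = - (K *m J).
  rewrite Jmx_tr mulmxN mulNmx -(mulmxA _ J) (cogram_J iso Hg) mulmxA.
  by rewrite -(mulmxA K) (gramK iso Hg) mulmx1.
rewrite linearN /= => /eqP; rewrite oppr_eq0 => /eqP trK.
have conn_sum : conn_mx phi nabla (E (c i j)) x = \sum_k c i j 0 k *: A k x.
  apply: (linear_row_sum (f := fun u => conn_mx phi nabla (E u) x)) => a v w.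
  exact: conn_mx_linear.
rewrite !derive_ricci_potential.
have trAA : \tr (A j x *m A i x *m J) = \tr (A i x *m A j x *m J).
  by rewrite -mulmxA -conn_mx_J mulmxA mxtrace_mulC mulmxA.
have trS : \tr (conn_mx phi nabla (E (c i j)) x *m J) = \sum_k c i j 0 k * ricci_potential k x.
  rewrite conn_sum mulmx_suml linear_sum /=; apply: eq_bigr => k _.
  by rewrite -scalemxAl linearZ_LR.
have : \tr (K *m J) = \tr ('D_(E (e_ i) x) (A j) x *m J) - \tr ('D_(E (e_ j) x) (A i) x *m J)
   + \tr (A j x *m A i x *m J) - \tr (A i x *m A j x *m J)
   - \tr (conn_mx phi nabla (E (c i j)) x *m J).
  have trB (a b : 'M[R]_6) : \tr (a - b) = \tr a - \tr b by rewrite linearB.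
  rewrite /K mulmxBl trB; congr (_ - _).
  rewrite mulmxBl trB; congr (_ - _).
  by rewrite mulmxDl mxtraceD mulmxBl trB.
by rewrite trK trAA trS addrK => /esym/eqP; rewrite subr_eq0 => /eqP.
Qed.

(** The fourth root of det G. Exponential and logarithm make it visibly
    smooth. *)
Definition conformal_weight x : R := expR (4^-1 * ln (\det (G x))).

Let smooth_ln_det : smooth (fun x => 4^-1 * ln (\det (G x))).
Proof.
apply: smoothM; first exact: smooth_cst.
apply: smooth_ln; first exact: (gram_det_gt0 iso Hg).
by apply: smooth_det => i j; apply: smooth_entry; exact: (smooth_gram Hg).
Qed.

Lemma conformal_weight_fun : M_fun conformal_weight.
Proof.
split; first exact: (smooth_expR smooth_ln_det).
by move=> a x ga; rewrite /conformal_weight (gram_invariant Hg x ga).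
Qed.

Lemma derive_conformal_weight u x :
  'D_(E u x) conformal_weight x = conformal_weight x * (4^-1 * \tr (H x *m 'D_(E u x) G x)).
Proof.
have sG := smooth_gram Hg; have d0 := gram_det_gt0 iso Hg x.
have sGe i j : smooth (fun x => G x i j) := smooth_entry i j sG.
have sd : smooth (fun x => \det (G x)) := smooth_det sGe.
have [_ ->] := derive_chain (E u x) (smooth_diff x smooth_ln_det) (is_derive_expR _).
congr (_ * _).
have sl : smooth (fun x => ln (\det (G x))).
  by apply: smooth_ln => //; exact: (gram_det_gt0 iso Hg).
rewrite (derive_mul x (E u x) (smooth_cst (4^-1 : R)) sl) (derive_cst (4^-1 : R)) mul0r add0r.
congr (_ * _).
have [_ ->] := derive_chain (E u x) (smooth_diff x sd) (is_derive1_ln d0).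
rewrite (derive_det x (E u x) sGe).
have -> : \matrix_(i, j) 'D_(E u x) (fun x => G x i j) x = 'D_(E u x) G x.
  apply/matrixP => i j; rewrite mxE.
  by rewrite (derive_entry i j (smooth_derivable x (E u x) sG)).
have -> : \adj (G x) = \det (G x) *: H x.
  rewrite /cogram /invmx (gram_unit iso Hg) scalerA mulfV ?scale1r//.
  by rewrite gt_eqF.
by rewrite -scalemxAl linearZ_LR mulrA mulVf ?mul1r// gt_eqF.
Qed.

Lemma bivector_fun j k : M_fun (fun x => conformal_weight x * (H x *m J) j k).
Proof.
split.
  apply: smoothM; first by case: conformal_weight_fun.
  apply: smooth_entry; apply: smooth_mulmx; last exact: smooth_cst.
  exact: (smooth_cogram iso Hg).
move=> a x ga; have [_ ->] := conformal_weight_fun => //.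
by rewrite /cogram (gram_invariant Hg x ga).
Qed.

Lemma divergence_bivector k x :
  \sum_j 'D_(E (e_ j) x) (fun x => conformal_weight x * (H x *m J) j k) x =
  conformal_weight x * (2^-1 * \sum_i ricci_potential i x * H x i k
            - 2^-1 * \sum_j \sum_l (H x *m J) j l * c j l 0 k).
Proof.
have sH := smooth_cogram iso Hg; have sG := smooth_gram Hg.
have sHJ : smooth (fun x => H x *m J).
  by apply: smooth_mulmx => //; exact: smooth_cst.
have GH x := gramK iso Hg x.
have := @bismut_divergence R 6 (fun i => A i x) (G x) (H x) J (fun i j => c i j)
  (GH x) (gram_sym Hg x) (@Jmx_tr R) (gram_J iso Hg x) (fun j => conn_mx_J (e_ j) x)
  (@gst_ad_trace R s t)
  (@gst_adJ_trace R s t) (torsion_skew x) k.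
move=> h; have {}h : 2^-1 * \sum_i ricci_potential i x * H x i k = _ := esym h.
rewrite h addrK.
transitivity (\sum_j conformal_weight x * (
    (- (H x *m (A j x *m G x + G x *m (A j x)^T) *m H x *m J)) j k
    + 2^-1 * (\tr (A j x) * (H x *m J) j k))).
  apply: eq_bigr => j _; rewrite (derive_mul x (E (e_ j) x) conformal_weight_fun.1 (smooth_entry j k sHJ)).
  rewrite derive_conformal_weight -(derive_entry j k (smooth_derivable x _ sHJ)).
  rewrite (derive_mulmx x (E (e_ j) x) sH (smooth_cst J)) (derive_cst J) mulmx0 addr0.
  rewrite (derive_invmx x (E (e_ j) x) sG sH GH) derive_gram.
  rewrite (metric_trace (fun i => A i x) (GH x)) mulNmx.
  by rewrite [\tr _ *+ 2]mulr2n; field.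
by rewrite -mulr_sumr big_split /= -mulr_sumr.
Qed.

(** B is antisymmetric, so differentiating the 1-form only sees its exterior
    derivative, which equals the structure constants contracted with it as the
    form is closed. This cancels the structure constants in
    [divergence_bivector]. *)
Lemma divergence_square x :
  \sum_j 'D_(E (e_ j) x) (fun x => \sum_k conformal_weight x * (H x *m J) j k * ricci_potential k x) x =
  conformal_weight x * (2^-1 * \sum_k (\sum_i ricci_potential i x * H x i k) * ricci_potential k x).
Proof.
pose B j k := (H x *m J) j k.
have sb k : smooth (ricci_potential k) by case: (ricci_potential_fun k).
have sB j k : smooth (fun x => conformal_weight x * (H x *m J) j k) by case: (bivector_fun j k).
have Ba j k : B j k = - B k j.
  exact: (bivector_anti (gramK iso Hg x) (gram_sym Hg x) (@Jmx_tr R) (gram_J iso Hg x)).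
transitivity (\sum_j \sum_k ('D_(E (e_ j) x) (fun x => conformal_weight x * (H x *m J) j k) x * ricci_potential k x
   + conformal_weight x * (B j k * 'D_(E (e_ j) x) (ricci_potential k) x))).
  apply: eq_bigr => j _; rewrite (derive_sum_fun _ _ (fun k => smoothM (sB j k) (sb k))).
  apply: eq_bigr => k _; rewrite (derive_mul x (E (e_ j) x) (sB j k) (sb k)).
  by rewrite -[in LHS]mulrA.
under eq_bigr => j _ do rewrite big_split /=.
rewrite big_split /= exchange_big /=.
under eq_bigr => k _ do rewrite -mulr_suml divergence_bivector.
have SS : \sum_j \sum_k B j k * 'D_(E (e_ j) x) (ricci_potential k) x =
    2^-1 * \sum_k (\sum_j \sum_l B j l * c j l 0 k) * ricci_potential k x.
  set S := LHS.
  have SN : \sum_j \sum_k B j k * 'D_(E (e_ k) x) (ricci_potential j) x = - S.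
    rewrite exchange_big /= -sumrN; apply: eq_bigr => k _; rewrite -sumrN.
    by apply: eq_bigr => j _; rewrite Ba mulNr.
  have : S - - S = \sum_k (\sum_j \sum_l B j l * c j l 0 k) * ricci_potential k x.
    rewrite -SN /S -sumrB.
    under [RHS]eq_bigr => k _ do rewrite mulr_suml.
    rewrite exchange_big /=; apply: eq_bigr => j _; rewrite -sumrB.
    under [RHS]eq_bigr => k _ do rewrite mulr_suml.
    rewrite exchange_big /=; apply: eq_bigr => l _.
    rewrite -mulrBr (ricci_potential_closed j l x) mulr_sumr.
    by apply: eq_bigr => k _; rewrite mulrA.
  by move=> <-; field.
under [X in _ + X]eq_bigr => j _ do rewrite -mulr_sumr.
rewrite -mulr_sumr SS -/B !mulr_sumr -big_split /=; apply: eq_bigr => k _.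
rewrite /B; ring.
Qed.

(** Let Q = |s| (H_11 + 2 H_33), the wanted positive term. By compactness some
    multiple K Q dominates H_55, and K times the divergence of the square then
    absorbs the mixed term 1/2 (beta H)_5. *)
Lemma ricci_flat_forces_s0 : s = 0.
Proof.
apply/eqP; apply/negP => /negP s0.
pose Q x := `|s| * (H x 0 0 + 2 * H x 2 2).
have Hd x i : 0 < H x i i.
  rewrite -(bilin_delta (H x)); apply: (cogram_pos iso Hg).
  by apply/eqP => /matrixP/(_ 0 i)/eqP; rewrite !mxE !eqxx oner_eq0.
have Q0 x : 0 < Q x.
  by rewrite mulr_gt0 ?normr_gt0// addr_gt0 ?mulr_gt0.
have sHe i j : smooth (fun x => H x i j).
  by apply: smooth_entry; exact: (smooth_cogram iso Hg).
have Ha a x : gauss a -> H (heis_mul a x) = H x.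
  by move=> ga; rewrite /cogram (gram_invariant Hg x ga).
have [C HC] : exists C, forall x, H x 4 4 / Q x <= C.
  apply: (invariant_bounded (f := fun x => H x 4 4 / Q x)).
    apply: smooth_cont; apply: smoothM => //; apply: smoothV.
      by move=> x; rewrite gt_eqF.
    apply: smoothM; first exact: smooth_cst.
    by apply: smoothD => //; apply: smoothM => //; exact: smooth_cst.
  by move=> a x ga; rewrite /Q (Ha a x ga).
pose K := Num.max C 1.
have K1 : 1 <= K by rewrite le_max lexx orbT.
have HK x : H x 4 4 <= K * Q x.
  by rewrite -ler_pdivrMr//; apply: le_trans (HC x) _; rewrite le_max lexx.
pose W j x := Num.sg s * (conformal_weight x * (H x *m J) j 4)
  + K * \sum_k conformal_weight x * (H x *m J) j k * ricci_potential k x.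
have MB j k := bivector_fun j k; have Mr k := ricci_potential_fun k.
have sWB j : smooth (fun x => \sum_k conformal_weight x * (H x *m J) j k * ricci_potential k x).
  by apply: smooth_sum => k; apply: smoothM; [case: (MB j k) | case: (Mr k)].
apply: (@no_positive_divergence R phi W) => [j|x].
  exact: (M_funD (M_funM (M_fun_cst _) (MB j 4))
    (M_funM (M_fun_cst K) (M_fun_sum (index_enum 'I_6) (fun k => M_funM (MB j k) (Mr k))))).
have cst_mul (a : R) (f : V -> R) v : smooth f -> 'D_v (fun x => a * f x) x = a * 'D_v f x.
  by move=> sf; rewrite (derive_mul x v (smooth_cst a) sf) (derive_cst a) mul0r add0r.
have sB4 j : smooth (fun x => conformal_weight x * (H x *m J) j 4) by case: (MB j 4).
have -> : \sum_j 'D_(E (e_ j) x) (W j) x =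
    Num.sg s * \sum_j 'D_(E (e_ j) x) (fun x => conformal_weight x * (H x *m J) j 4) x
   + K * \sum_j 'D_(E (e_ j) x) (fun x => \sum_k conformal_weight x * (H x *m J) j k * ricci_potential k x) x.
  rewrite !mulr_sumr -big_split /=; apply: eq_bigr => j _.
  rewrite -(cst_mul _ _ _ (sB4 j)) -(cst_mul _ _ _ (sWB j)).
  have sc a (f : V -> R) : smooth f -> smooth (fun x => a * f x).
    by move=> sf; apply: smoothM => //; exact: smooth_cst.
  exact: (deriveD (smooth_derivable _ _ (sc _ _ (sB4 j))) (smooth_derivable _ _ (sc _ _ (sWB j)))).
rewrite divergence_bivector divergence_square.
rewrite (contract_de5 s t (cogram_sym iso Hg x) (cogram_J iso Hg x)).
pose b := \row_k ricci_potential k x.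
have b4E : \sum_i ricci_potential i x * H x i 4 = (b *m H x) 0 4.
  by rewrite mxE; apply: eq_bigr => i _; rewrite mxE.
have bbE : \sum_k (\sum_i ricci_potential i x * H x i k) * ricci_potential k x = (b *m H x *m b^T) 0 0.
  rewrite mxE; apply: eq_bigr => k _; rewrite [b^T k 0]mxE [b 0 k]mxE; congr (_ * _).
  by rewrite mxE; apply: eq_bigr => i _; rewrite mxE.
rewrite b4E bbE.
have m0 : 0 < conformal_weight x by exact: expR_gt0.
rewrite !(mulrCA _ (conformal_weight x)) -mulrDr pmulr_rgt0//.
(* Complete the square: K |beta|^2 + sg s (beta H)_5 is K times the square of
   beta + sg s / (2 K) e^5, up to H_55 / (4 K), which is at most Q / 4. *)
have K0 : 0 < K by exact: lt_le_trans ltr01 K1.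
pose a := Num.sg s / (2 * K).
have := cogram_ge0 iso Hg x (b + a *: e_ 4).
have bil (u v : V) : (u *m H x *m v^T) 0 0 = (v *m H x *m u^T) 0 0.
  transitivity ((u *m H x *m v^T)^T 0 0); first by rewrite [RHS]mxE.
  by rewrite trmx_mul trmxK trmx_mul (cogram_sym iso Hg x) mulmxA.
have e4E (u : V) : (u *m H x *m (e_ 4)^T) 0 0 = (u *m H x) 0 4.
  by rewrite trmx_delta -colE mxE.
pose f (u v : V) := (u *m H x *m v^T) 0 0.
have fD u v w : f (u + v) w = f u w + f v w by rewrite /f !mulmxDl mxE.
have fZ c' u w : f (c' *: u) w = c' * f u w by rewrite /f -!scalemxAl mxE.
have fS u v : f u v = f v u by exact: bil.
have -> : ((b + a *: e_ 4) *m H x *m (b + a *: e_ 4)^T) 0 0 =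
    f b b + a * f (e_ 4) b + a * (f (e_ 4) b + a * f (e_ 4) (e_ 4)).
  rewrite -/(f (b + a *: e_ 4) (b + a *: e_ 4)) fD fZ (fS b) (fS (e_ 4)) !fD !fZ.
  by rewrite (fS b (e_ 4)).
rewrite (fS (e_ 4) b).
have -> : f b (e_ 4) = (b *m H x) 0 4 by exact: e4E.
have -> : f (e_ 4) (e_ 4) = H x 4 4 by exact: bilin_delta.
rewrite -/(f b b); move: (f b b) ((b *m H x) 0 4) => bb b4 sq.
have sgs : Num.sg s * s = `|s| by rewrite -normrEsg.
have aK : a * K = 2^-1 * Num.sg s.
  by rewrite /a; field; rewrite gt_eqF.
have a2K : a ^+ 2 * K ^+ 2 = 4^-1.
  by rewrite -exprMn aK exprMn sqr_sg s0 mulr1; field.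
have E1 : K * (bb + a * b4 + a * (b4 + a * H x 4 4)) - a ^+ 2 * K * H x 4 4
    = K * bb + Num.sg s * b4.
  transitivity (K * bb + 2 * (a * K) * b4); first by ring.
  by rewrite aK; field.
have -> : Num.sg s * (2^-1 * b4 - 2^-1 * - (2 * (s * (H x 0 0 + 2 * H x 2 2)))) +
    K * (2^-1 * bb) = Q x + 2^-1 * (K * bb + Num.sg s * b4).
  by rewrite /Q -sgs; field.
have E2 : a ^+ 2 * K * H x 4 4 <= 4^-1 * Q x.
  have -> : 4^-1 * Q x = a ^+ 2 * K * (K * Q x) by rewrite -a2K; ring.
  by apply: ler_wpM2l (HK x); rewrite mulr_ge0 ?sqr_ge0 ?ltW.
have E3 := mulr_ge0 (ltW K0) sq; have Qx := Q0 x.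
rewrite -E1; lra.
Qed.

End RicciFlat.

(** * The Bismut connection of the invariant metric when s = 0 *)

Section AdMatrix.
Variables (R : realType) (t : R).
Local Notation V := 'rV[R]_6.
Local Notation e_ := (delta_mx 0 : 'I_6 -> V).
Local Notation J := (@Jmx R).
Local Notation br := (gst_br 0 t).

Definition ad_mx (u : V) : 'M[R]_6 := \matrix_(i < 6) br u (e_ i).
(** The Levi-Civita connection is 1/2 (ad_u v - (ad_u)^T v - (ad_v)^T u).
    Adding half of the torsion ad_u v - (ad_u)^T v + (ad_v)^T u cancels
    (ad_v)^T u, which is the only term that is not complex linear in v. *)
Definition bismut_mx (u : V) : 'M[R]_6 := ad_mx u - (ad_mx u)^T.

Lemma mul_ad_mx u v : v *m ad_mx u = br u v.
Proof.
rewrite mulmx_sum_row (linear_row_sum (f := br u)).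
  by apply: eq_bigr => i _; rewrite rowK.
by move=> a v1 v2; rewrite (gst_br_bilin 0 t).2.
Qed.

Lemma bismut_mx_linear a u v :
  bismut_mx (a *: u + v) = a *: bismut_mx u + bismut_mx v.
Proof.
have adl : ad_mx (a *: u + v) = a *: ad_mx u + ad_mx v.
  apply/row_matrixP => i; rewrite linearP /= !rowK.
  by rewrite (gst_br_bilin 0 t).1.
by rewrite /bismut_mx adl linearP /= scalerBr opprD addrACA.
Qed.

Lemma bismut_mx_tr u : (bismut_mx u)^T = - bismut_mx u.
Proof. by rewrite /bismut_mx linearB /= trmxK opprB. Qed.

Lemma gst_brJ u v : br u (v *m J) = br u v *m J.
Proof.
rewrite -!gst_JE; apply/rowP; apply: forall_ord6;
by rewrite !mxE /= ?/de5 ?/de6 /wedge ?mxE /=; ring.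
Qed.

(** For s = 0 the bracket is complex bilinear. *)
Lemma bismut_mx_J u : bismut_mx u *m J = J *m bismut_mx u.
Proof.
have adJ : J *m ad_mx u = ad_mx u *m J.
  apply/row_matrixP => i; rewrite !rowE !mulmxA !mul_ad_mx; exact: gst_brJ.
have adJt : (ad_mx u)^T *m J = J *m (ad_mx u)^T.
  have := congr1 trmx adJ; rewrite !trmx_mul Jmx_tr mulmxN mulNmx.
  exact: oppr_inj.
by rewrite /bismut_mx mulmxBl (mulmxBr J) adJ adJt.
Qed.

(** Brackets are central. *)
Lemma bismut_mx_br u v : bismut_mx (br u v) = 0.
Proof.
have ad0 : ad_mx (br u v) = 0.
  apply/row_matrixP => i; rewrite rowK row0.
  by apply/rowP; apply: forall_ord6; rewrite !mxE /= ?/de5 ?/de6 /wedge ?mxE /=; ring.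
by rewrite /bismut_mx ad0 trmx0 subr0.
Qed.

Definition torsion_form (v w : V) := w *m bismut_mx v - v *m bismut_mx w - br v w.

(** The torsion paired with a third vector is the cyclic sum of [br] paired
    with the remaining vector. *)
Lemma torsion_form_skew (u v w : V) :
  (u *m (torsion_form v w)^T) 0 0 = - (v *m (torsion_form u w)^T) 0 0.
Proof.
pose d (a b : V) := (a *m b^T) 0 0.
have dC a b : d a b = d b a.
  transitivity ((a *m b^T)^T 0 0); first by rewrite [RHS]mxE.
  by rewrite trmx_mul trmxK.
have dB a b c : d a (b - c) = d a b - d a c by rewrite /d linearB /= mulmxBr [LHS]mxE [X in _ + X]mxE.
have dT a b c : d a (b *m (ad_mx c)^T) = d (br c a) b.
  by rewrite /d trmx_mul trmxK mulmxA mul_ad_mx.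
have dN a b : d (- a) b = - d a b by rewrite /d mulNmx mxE.
have brN a b : br a b = - br b a by exact: gst_br_anti.
have E a b c : d a (torsion_form b c) = d a (br b c) - d (br b a) c + d (br c a) b.
  rewrite /torsion_form /bismut_mx !mulmxBr !mul_ad_mx !dB !dT (brN c b) (dC a (- _)) dN (dC _ a).
  by rewrite !opprB; ring.
rewrite -/(d u _) -/(d v _) !E (brN v u) (brN w u) (brN w v) !dN.
by rewrite (dC u (br v w)) (dC v (br u w)); ring.
Qed.

End AdMatrix.

Section Backward.
Variables (R : realType) (t : R) (phi : 'M[R]_6).
Local Notation V := 'rV[R]_6.
Local Notation e_ := (delta_mx 0 : 'I_6 -> V).
Local Notation J := (@Jmx R).
Local Notation br := (gst_br 0 t).
Local Notation Gm := (bismut_mx t).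
Hypothesis iso : lie_iso 0 t phi.
Local Notation E := (frame phi).
Local Notation cf := (coframe phi).

Definition coframe_mx (x : V) : 'M[R]_6 := left_mx (heis_inv x) *m invmx phi.
Definition inv_metric (x : V) : 'M[R]_6 := coframe_mx x *m (coframe_mx x)^T.
Definition inv_conn (X Y : V -> V) : V -> V :=
  fun x => E ('D_(X x) (cf Y) x + cf Y x *m Gm (cf X x)) x.

Lemma row_dotE (a b : V) : (a *m b^T) 0 0 = \sum_k a 0 k * b 0 k.
Proof. by rewrite mxE; apply: eq_bigr => k _; rewrite mxE. Qed.

Lemma inv_metricE x (X Y : V -> V) :
  gval inv_metric x (X x) (Y x) = (cf X x *m (cf Y x)^T) 0 0.
Proof.
by rewrite /gval /inv_metric /coframe /coframe_mx !trmx_mul !mulmxA.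
Qed.

Lemma coframe_inv_conn X Y x : cf (inv_conn X Y) x = 'D_(X x) (cf Y) x + cf Y x *m Gm (cf X x).
Proof. exact: (frameK iso (fun x => 'D_(X x) (cf Y) x + cf Y x *m Gm (cf X x))). Qed.

Lemma coframe_Jphi (X : V -> V) x : cf (fun y => Jphi phi y (X y)) x = cf X x *m J.
Proof.
have -> : (fun y => Jphi phi y (X y)) = fun y => E (cf X y *m J) y.
  by apply/funext => y; rewrite -(Jphi_frame iso) (coframeK iso).
exact: (frameK iso (fun y => cf X y *m J)).
Qed.

Lemma Jphi_coframe (X : V -> V) x : Jphi phi x (X x) = E (cf X x *m J) x.
Proof. by rewrite -(Jphi_frame iso) (coframeK iso). Qed.

Lemma coframe_mx_inj x (u : V) : u != 0 -> u *m coframe_mx x != 0.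
Proof.
apply: contra_neq => u0.
have := coframeK iso (fun=> u) x; rewrite /coframe -mulmxA -/(coframe_mx x) u0.
by rewrite /frame !mul0mx.
Qed.

Lemma rV_sqr_gt0 (u : V) : u != 0 -> 0 < (u *m u^T) 0 0.
Proof.
move=> u0; have [i ui] : exists i, u 0 i != 0.
  apply/existsP; rewrite -negb_forall; apply: contra u0 => /forallP uz.
  by apply/eqP/rowP => i; rewrite mxE; exact/eqP.
rewrite mxE (bigD1 i)//= ltr_pwDl//.
  by rewrite mxE -expr2 lt_neqAle sqr_ge0 andbT eq_sym sqrf_eq0.
by apply: sumr_ge0 => k _; rewrite mxE -expr2 sqr_ge0.
Qed.

Lemma inv_metric_hermitian : hermitian_metric (Jphi phi) inv_metric.
Proof.
have sc : smooth coframe_mx.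
  by apply: smooth_mulmx; [exact: smooth_left_mx_inv | exact: smooth_cst].
have gE x (u v : V) : gval inv_metric x u v = (u *m coframe_mx x *m (v *m coframe_mx x)^T) 0 0.
  by rewrite /gval /inv_metric (trmx_mul v) !mulmxA.
split; first split.
- apply: smooth_mulmx => //; apply: smooth_mx => i j.
  rewrite (_ : (fun x => _) = fun x => coframe_mx x j i); first exact: smooth_entry.
  by apply/funext => x; rewrite mxE.
- move=> a x u v ga.
  have ac : left_mx a *m coframe_mx (heis_mul a x) = coframe_mx x.
    rewrite /coframe_mx mulmxA; congr (_ *m _).
    rewrite -[LHS]mul1mx -(left_mx_invl x) -mulmxA (mulmxA (left_mx x)) -left_mx_mul.
    by rewrite left_mx_inv mulmx1.
  by rewrite !gE !dleftE -(mulmxA u) -(mulmxA v) ac.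
- move=> x u v; rewrite !gE.
  transitivity ((u *m coframe_mx x *m (v *m coframe_mx x)^T)^T 0 0); first by rewrite [RHS]mxE.
  by rewrite trmx_mul trmxK.
- by move=> x u u0; rewrite gE; apply: rV_sqr_gt0; exact: coframe_mx_inj.
move=> x u v.
have Jc (w : V) : Jphi phi x w *m coframe_mx x = w *m coframe_mx x *m J.
  by have := coframe_Jphi (fun=> w) x; rewrite /coframe -!mulmxA.
rewrite !gE !Jc trmx_mul mulmxA -(mulmxA _ J) Jmx_tr mulmxN Jmx_sqr opprK mulmx1.
by [].
Qed.

Lemma smooth_coframe X : M_field X -> smooth (cf X).
Proof. by move=> MX; have [] := coframe_inv phi MX. Qed.

Lemma derive_row_linear (y : V -> V) x a (u v : V) : smooth y ->
  'D_(a *: u + v) y x = a *: 'D_u y x + 'D_v y x.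
Proof. by move=> sy; rewrite !(deriveE _ (smooth_diff x sy)) linearP. Qed.

Lemma derive_scale (f : V -> R) (y : V -> V) x v : smooth f -> smooth y ->
  'D_v (fun x => f x *: y x) x = 'D_v f x *: y x + f x *: 'D_v y x.
Proof.
move=> sf sy; have sye i j : smooth (fun x => y x i j) := smooth_entry i j sy.
have sfy : smooth (fun x => f x *: y x).
  apply: smooth_mx => i j; rewrite (_ : (fun x => _) = (fun x => f x * y x i j)).
    exact: smoothM.
  by apply/funext => z; rewrite mxE.
apply/matrixP => i j; rewrite (derive_entry i j (smooth_derivable x v sfy)).
have -> : (fun x => (f x *: y x) i j) = fun x => f x * y x i j.
  by apply/funext => z; rewrite mxE.
rewrite (derive_mul x v sf (sye i j)) !mxE; congr (_ + _ * _).
by rewrite (derive_entry i j (smooth_derivable x v sy)).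
Qed.

Lemma bismut_mx_sum u : Gm u = \sum_k u 0 k *: Gm (e_ k).
Proof. apply: (linear_row_sum (f := Gm)); exact: bismut_mx_linear. Qed.

Lemma smooth_bismut_mx (y : V -> V) : smooth y -> smooth (fun x => Gm (y x)).
Proof.
move=> sy; rewrite (_ : (fun x => _) = fun x => \sum_k y x 0 k *: Gm (e_ k)).
  by apply: smooth_sum => k; apply: smoothZl; exact: smooth_entry.
by apply/funext => x; exact: bismut_mx_sum.
Qed.

Lemma derive_bismut_mx (y : V -> V) x v : smooth y ->
  'D_v (fun x => Gm (y x)) x = Gm ('D_v y x).
Proof.
move=> sy; have sG := smooth_bismut_mx sy.
have sye i k : smooth (fun x => y x i k) := smooth_entry i k sy.
apply/matrixP => i j; rewrite (derive_entry i j (smooth_derivable x v sG)).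
have -> : (fun x => Gm (y x) i j) = fun x => \sum_k y x 0 k * Gm (e_ k) i j.
  by apply/funext => z; rewrite bismut_mx_sum summxE; apply: eq_bigr => k _; rewrite mxE.
rewrite (derive_sum_fun _ _ (fun k => smoothM (sye 0 k) (smooth_cst _))).
rewrite bismut_mx_sum summxE; apply: eq_bigr => k _.
rewrite (derive_mul x v (sye 0 k) (smooth_cst _)) (derive_cst (Gm (e_ k) i j)).
rewrite mulr0 addr0 [RHS]mxE; congr (_ * _).
by rewrite (derive_entry 0 k (smooth_derivable x v sy)).
Qed.

Lemma inv_conn_field X Y : M_field X -> M_field Y -> M_field (inv_conn X Y).
Proof.
move=> MX MY; have [sX Xa] := coframe_inv phi MX; have [sY Ya] := coframe_inv phi MY.
apply: frame_field.
have Dent i : M_fun (fun x => ('D_(X x) (cf Y) x) 0 i).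
  have -> : (fun x => ('D_(X x) (cf Y) x) 0 i) = fun x => 'D_(X x) (fun y => cf Y y 0 i) x.
    by apply/funext => x; rewrite (derive_entry 0 i (smooth_derivable x (X x) sY)).
  exact: (M_fun_derive (M_fun_entry i (conj sY Ya)) MX).
split.
  apply: smoothD.
    by apply: smooth_mx => i j; rewrite (ord1 i); case: (Dent j).
  exact: (smooth_mulmx sY (smooth_bismut_mx sX)).
move=> a x ga.
have Dax : 'D_(X (heis_mul a x)) (cf Y) (heis_mul a x) = 'D_(X x) (cf Y) x.
  by apply/rowP => i; have [_ Da] := Dent i; exact: (Da a x ga).
by rewrite Dax (Xa a x ga) (Ya a x ga).
Qed.

Lemma inv_conn_connection : M_connection inv_conn.
Proof.
have cfD (X Y : V -> V) x : cf (X \+ Y) x = cf X x + cf Y x by rewrite /coframe !mulmxDl.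
have cfZ (f : V -> R) (X : V -> V) x : cf (fun x => f x *: X x) x = f x *: cf X x.
  by rewrite /coframe -!scalemxAl.
have EL a u v x : E (a *: u + v) x = a *: E u x + E v x by exact: frame_linear.
have D1 (y : V -> V) x u v : smooth y -> 'D_(u + v) y x = 'D_u y x + 'D_v y x.
  by move=> sy; have := derive_row_linear x 1 u v sy; rewrite !scale1r.
have DZ (y : V -> V) x a u : smooth y -> 'D_(a *: u) y x = a *: 'D_u y x.
  move=> sy; have := derive_row_linear x a u 0 sy.
  by rewrite addr0 derive0 addr0.
have G1 u v : Gm (u + v) = Gm u + Gm v.
  by have := bismut_mx_linear t 1 u v; rewrite !scale1r.
have G0 : Gm 0 = 0.
  by have := G1 0 0; rewrite addr0 => /eqP; rewrite -subr_eq0 opprD addrA subrr sub0r oppr_eq0 => /eqP.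
have GZ a u : Gm (a *: u) = a *: Gm u.
  by have := bismut_mx_linear t a u 0; rewrite addr0 G0 addr0.
have E1 u v x : E (u + v) x = E u x + E v x.
  by have := EL 1 u v x; rewrite !scale1r.
have EZ a u x : E (a *: u) x = a *: E u x by rewrite /frame -!scalemxAl.
split.
- exact: inv_conn_field.
- move=> X X' Y MX MX' MY; have sY := smooth_coframe MY.
  apply/funext => x.
  have h : inv_conn (X \+ X') Y x = E ('D_(X x + X' x) (cf Y) x + cf Y x *m Gm (cf X x + cf X' x)) x.
    by rewrite /inv_conn (cfD X X').
  rewrite h (D1 _ _ _ _ sY) G1 mulmxDr addrACA E1.
  by [].
- move=> f X Y Mf MX MY; have sY := smooth_coframe MY.
  apply/funext => x.
  have h : inv_conn (fun x => f x *: X x) Y x = E ('D_(f x *: X x) (cf Y) x + cf Y x *m Gm (f x *: cf X x)) x.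
    by rewrite /inv_conn (cfZ f X).
  rewrite h (DZ _ _ _ _ sY) GZ -scalemxAr -scalerDr EZ.
  by [].
- move=> X Y Y' MX MY MY'; have sY := smooth_coframe MY; have sY' := smooth_coframe MY'.
  apply/funext => x.
  have cD : cf (Y \+ Y') = cf Y + cf Y' by apply/funext => z; exact: cfD.
  have DD : 'D_(X x) (cf Y + cf Y') x = 'D_(X x) (cf Y) x + 'D_(X x) (cf Y') x.
    exact: (deriveD (smooth_derivable x (X x) sY) (smooth_derivable x (X x) sY')).
  rewrite /inv_conn cD DD.
  have -> : (cf Y + cf Y') x = cf Y x + cf Y' x by [].
  by rewrite mulmxDl addrACA E1.
- move=> f X Y [sf fa] MX MY; have sY := smooth_coframe MY.
  apply/funext => x.
  have cZ : cf (fun x => f x *: Y x) = fun x => f x *: cf Y x by apply/funext => z; exact: cfZ.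
  rewrite /inv_conn cZ (derive_scale x (X x) sf sY) -scalemxAl -addrA -scalerDr EL EZ.
  by rewrite (coframeK iso).
Qed.

Lemma coframe_field_br (A B : V -> V) x : M_field A -> M_field B ->
  cf (field_br A B) x =
  'D_(A x) (cf B) x - 'D_(B x) (cf A) x + br (cf A x) (cf B x).
Proof.
move=> MA MB.
have AE : A = fun y => E (cf A y) y by apply/funext => y; rewrite (coframeK iso).
have BE : B = fun y => E (cf B y) y by apply/funext => y; rewrite (coframeK iso).
have fE : field_br A B x = E ('D_(A x) (cf B) x - 'D_(B x) (cf A) x + br (cf A x) (cf B x)) x.
  rewrite {1}AE {1}BE (field_br_frame iso x (smooth_coframe MA) (smooth_coframe MB)).
  by rewrite !(coframeK iso).
rewrite /coframe fE; exact: (coframe_frame iso _ x).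
Qed.

Lemma inv_conn_bismut : bismut_connection (Jphi phi) inv_metric inv_conn.
Proof.
split; first exact: inv_conn_connection.
- move=> X Y Z MX MY MZ x; have sY := smooth_coframe MY; have sZ := smooth_coframe MZ.
  have -> : (fun y => gval inv_metric y (Y y) (Z y)) =
      fun y => \sum_k cf Y y 0 k * cf Z y 0 k.
    by apply/funext => y; rewrite inv_metricE row_dotE.
  have sYk k := smooth_entry 0 k sY; have sZk k := smooth_entry 0 k sZ.
  rewrite (derive_sum_fun _ _ (fun k => smoothM (sYk k) (sZk k))).
  rewrite (inv_metricE x (inv_conn X Y) Z) (inv_metricE x Y (inv_conn X Z)) !coframe_inv_conn.
  have -> : ('D_(X x) (cf Z) x + cf Z x *m Gm (cf X x))^T =
      ('D_(X x) (cf Z) x)^T - Gm (cf X x) *m (cf Z x)^T.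
    by rewrite linearD /= trmx_mul bismut_mx_tr mulNmx.
  have skew_cancel (y dy z dz : V) (M : 'M[R]_6) :
      ((dy + y *m M) *m z^T) 0 0 + (y *m (dz^T - M *m z^T)) 0 0
      = (dy *m z^T) 0 0 + (y *m dz^T) 0 0.
    rewrite mulmxDl mulmxBr (mulmxA y).
    move: (dy *m z^T) (y *m M *m z^T) (y *m dz^T) => a b c; rewrite !mxE; ring.
  rewrite skew_cancel !row_dotE -big_split /=; apply: eq_bigr => k _.
  rewrite (derive_mul x (X x) (sYk k) (sZk k)).
  rewrite (derive_entry 0 k (smooth_derivable x (X x) sY)).
  by rewrite (derive_entry 0 k (smooth_derivable x (X x) sZ)).
- move=> X Y MX MY x; have sY := smooth_coframe MY.
  rewrite (Jphi_coframe (inv_conn X Y)) coframe_inv_conn /inv_conn.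
  have -> : cf (fun y => Jphi phi y (Y y)) = fun y => cf Y y *m J.
    by apply/funext => y; exact: coframe_Jphi.
  rewrite (derive_mulmx x (X x) sY (smooth_cst J)) (derive_cst J) mulmx0 addr0.
  by rewrite mulmxDl -!mulmxA bismut_mx_J.
move=> X Y Z MX MY MZ x.
have torE (A B : V -> V) : M_field A -> M_field B ->
    cf (torsion inv_conn A B) x = torsion_form t (cf A x) (cf B x).
  move=> MA MB; have -> : cf (torsion inv_conn A B) x =
     cf (inv_conn A B) x - cf (inv_conn B A) x - cf (field_br A B) x.
    by rewrite /coframe /torsion !mulmxBl.
  rewrite (coframe_field_br x MA MB).
  have cancel (a' b' a b p q r : V) : a' = a + p -> b' = b + q ->
      a' - b' - (a - b + r) = p - q - r.
    by move=> -> ->; apply/rowP => i; rewrite !mxE; ring.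
  by apply: cancel; exact: coframe_inv_conn.
rewrite (inv_metricE x X (torsion inv_conn Y Z)) (inv_metricE x Y (torsion inv_conn X Z)).
apply: etrans (congr1 (fun w => (cf X x *m w^T) 0 0) (torE Y Z MY MZ)) _.
apply: etrans (torsion_form_skew t _ _ _) _.
exact: (congr1 (fun w => - (cf Y x *m w^T) 0 0) (esym (torE X Z MX MZ))).
Qed.

(** Holds for arbitrary vector fields: the second derivatives of the
    coefficients of Z combine to the derivative along the bracket of X and Y,
    and the connection matrix kills brackets. *)
Lemma coframe_curvature_inv (X Y Z : V -> V) x : M_field X -> M_field Y -> M_field Z ->
  cf (curvature inv_conn X Y Z) x =
  cf Z x *m (Gm (cf Y x) *m Gm (cf X x) - Gm (cf X x) *m Gm (cf Y x)).
Proof.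
move=> MX MY MZ; have sX := smooth_coframe MX; have sY := smooth_coframe MY; have sZ := smooth_coframe MZ.
have two (A B : V -> V) : M_field A -> M_field B ->
    cf (inv_conn A (inv_conn B Z)) x =
    'D_(A x) (fun p => 'D_(B p) (cf Z) p) x
    + ('D_(A x) (cf Z) x *m Gm (cf B x) + cf Z x *m Gm ('D_(A x) (cf B) x))
    + ('D_(B x) (cf Z) x + cf Z x *m Gm (cf B x)) *m Gm (cf A x).
  move=> MA MB; have sB := smooth_coframe MB; have sGB := smooth_bismut_mx sB.
  have cB : cf (inv_conn B Z) = fun p => 'D_(B p) (cf Z) p + cf Z p *m Gm (cf B p).
    by apply/funext => p; exact: coframe_inv_conn.
  have sD : smooth (fun p => 'D_(B p) (cf Z) p).
    have -> : (fun p => 'D_(B p) (cf Z) p) =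
        fun p => cf (inv_conn B Z) p + (-1 : R) *: (cf Z p *m Gm (cf B p)).
      by apply/funext => p; rewrite cB scaleN1r addrK.
    apply: smoothD; first by apply: smooth_coframe; exact: inv_conn_field.
    apply: smooth_mx => i j.
    have -> : (fun p => ((-1 : R) *: (cf Z p *m Gm (cf B p))) i j) =
        fun p => -1 * (cf Z p *m Gm (cf B p)) i j by apply/funext => p; rewrite mxE.
    apply: smoothM; first exact: smooth_cst.
    exact: (smooth_entry i j (smooth_mulmx sZ sGB)).
  have sP := smooth_mulmx sZ sGB.
  rewrite (coframe_inv_conn A (inv_conn B Z) x) cB.
  have -> : 'D_(A x) (fun p => 'D_(B p) (cf Z) p + cf Z p *m Gm (cf B p)) x =
      'D_(A x) (fun p => 'D_(B p) (cf Z) p) x + 'D_(A x) (fun p => cf Z p *m Gm (cf B p)) x.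
    exact: (deriveD (smooth_derivable x (A x) sD) (smooth_derivable x (A x) sP)).
  by rewrite (derive_mulmx x (A x) sZ sGB) (derive_bismut_mx x (A x) sB).
have brE : cf (field_br X Y) x = 'D_(X x) (cf Y) x - 'D_(Y x) (cf X) x + br (cf X x) (cf Y x).
  exact: coframe_field_br.
have -> : cf (curvature inv_conn X Y Z) x = cf (inv_conn X (inv_conn Y Z)) x
    - cf (inv_conn Y (inv_conn X Z)) x - cf (inv_conn (field_br X Y) Z) x.
  by rewrite /coframe /curvature !mulmxBl.
have GD u v : Gm (u + v) = Gm u + Gm v.
  by have := bismut_mx_linear t 1 u v; rewrite !scale1r.
have GB u v : Gm (u - v) = Gm u - Gm v.
  have -> : u - v = (-1) *: v + u by rewrite scaleN1r addrC.
  by rewrite bismut_mx_linear scaleN1r addrC.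
have three : cf (inv_conn (field_br X Y) Z) x =
    ('D_(X x) (fun p => 'D_(Y p) (cf Z) p) x - 'D_(Y x) (fun p => 'D_(X p) (cf Z) p) x)
    + cf Z x *m (Gm ('D_(X x) (cf Y) x) - Gm ('D_(Y x) (cf X) x)).
  apply: etrans (coframe_inv_conn _ _ _) _.
  apply: (congr2 (fun u v : V => u + v)).
    exact: (esym (derive_field_br_row x sZ MX.1 MY.1)).
  apply: (congr1 (mulmx (cf Z x))).
  by rewrite brE GD GB bismut_mx_br addr0.
have algebra (a b c dXY dYX dX dY z : V) (M N P Q : 'M[R]_6) :
    a = dXY + (dX *m N + z *m P) + (dY + z *m N) *m M ->
    b = dYX + (dY *m M + z *m Q) + (dX + z *m M) *m N ->
    c = (dXY - dYX) + z *m (P - Q) ->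
    a - b - c = z *m (N *m M - M *m N).
  move=> -> -> ->; rewrite !mulmxDl !mulmxBr !mulmxA.
  move: (dX *m N) (z *m P) (dY *m M) (z *m N *m M) (z *m Q) (z *m M *m N) => p q r u v w.
  by apply/rowP => i; rewrite !mxE; ring.
exact: (algebra _ _ _ _ _ _ _ _ _ _ _ _ (two X Y MX MY) (two Y X MY MX) three).
Qed.

(** The trace of J against a commutator of matrices commuting with J. *)
Lemma inv_conn_ricci_flat : ricci_flat (Jphi phi) inv_metric inv_conn.
Proof.
move=> x e Me on X Y MX MY; rewrite /ricci_form.
pose Q : 'M[R]_6 := \matrix_(i < 6) cf (e i) x.
pose K := Gm (cf Y x) *m Gm (cf X x) - Gm (cf X x) *m Gm (cf Y x).
have QQ : Q *m Q^T = 1%:M.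
  apply/matrixP => i j; rewrite -[LHS]bilin_delta !mulmxA -rowE -mulmxA -trmx_mul -rowE.
  by rewrite !rowK -inv_metricE on mxE.
have QtQ := mulmx1C QQ.
have trK : \tr (K *m J) = 0.
  have -> : K *m J = Gm (cf Y x) *m (J *m Gm (cf X x)) - Gm (cf X x) *m Gm (cf Y x) *m J.
    by rewrite /K mulmxBl -(mulmxA (Gm (cf Y x))) bismut_mx_J.
  rewrite linearB /= mulmxA mxtrace_mulC mulmxA subrr.
  by [].
have -> : \sum_i gval inv_metric x (curvature inv_conn X Y (e i) x) (Jphi phi x (e i x))
    = \tr (Q *m (K *m J^T) *m Q^T).
  apply: eq_bigr => i _.
  rewrite (inv_metricE x (curvature inv_conn X Y (e i)) (fun y => Jphi phi y (e i y))).
  rewrite coframe_Jphi -[RHS]bilin_delta.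
  apply: etrans (congr1 (fun w : V => (w *m (cf (e i) x *m J)^T) 0 0) (coframe_curvature_inv x MX MY (Me i))) _.
  by rewrite -(rowK (fun i => cf (e i) x) i) rowE -/K -/Q !trmx_mul !mulmxA.
rewrite mxtrace_mulC (mulmxA Q^T) QtQ mul1mx Jmx_tr mulmxN linearN /= trK oppr0 mulr0.
by [].
Qed.

End Backward.

Local Close Scope classical_set_scope.

Theorem theorem4p2 (R : realType) (s t : R) (t_neq0 : t != 0)
    (phi : 'M[R]_6) (phi_iso : lie_iso s t phi) :
  (exists g : 'rV[R]_6 -> 'M[R]_6,
     hermitian_metric (Jphi phi) g /\
     exists nabla : ('rV[R]_6 -> 'rV[R]_6) -> ('rV[R]_6 -> 'rV[R]_6) ->
                    ('rV[R]_6 -> 'rV[R]_6),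
       bismut_connection (Jphi phi) g nabla /\
       ricci_flat (Jphi phi) g nabla)
  <-> s = 0.
Proof.
split=> [[g [Hg [nabla [Hn flat]]]]|s0].
  exact: (ricci_flat_forces_s0 phi_iso Hg Hn flat).
move: phi_iso; rewrite s0 => iso.
exists (inv_metric phi); split; first exact: (inv_metric_hermitian iso).
exists (inv_conn t phi); split; first exact: (inv_conn_bismut iso).
exact: (inv_conn_ricci_flat iso).
Qed.
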